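(* There is an algorithm to solve (compute the values of all vertices of) any strongly connected almost-acyclic simple stochastic game in time $O(n)$, where $n$ is the number of vertices.
   Context: A simple stochastic game (SSG) is a finite directed graph $G=(V,A)$ with a partition $V=V_{MAX}\cup V_{MIN}\cup V_{AVE}\cup V_{SINK}$. Each sink has a rational value in $[0,1]$ and its only outgoing arc is a loop on itself (not counted as a cycle); each average vertex has outdegree exactly $2$; positional vertices have at least one outgoing arc. A strategy for MAX is a map $\sigma:V_{MAX}\to V$ with $(x,\sigma(x))\in A$; strategies $\tau$ for MIN analogously. Given $\sigma,\tau$ and a start vertex, a random play moves from a MAX vertex $x$ to $\sigma(x)$, from a MIN vertex to $\tau(x)$, stays at sinks, and from an average vertex to each of its two out-neighbours with probability $1/2$ independently; its payoff is the value of the sink reached ($0$ if none). $\mathrm{Val}_{\sigma,\tau}(x)$ is the expected payoff from $x$ and $\mathrm{Val}(x)=\max_\sigma\min_\tau\mathrm{Val}_{\sigma,\tau}(x)=\min_\tau\max_\sigma\mathrm{Val}_{\sigma,\tau}(x)$. An SSG is almost-acyclic if every non-sink vertex (positional or average) has at most one outgoing arc lying on a directed cycle. It is strongly connected if the underlying directed graph with sinks removed is strongly connected. Running times count arithmetic operations and comparisons.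
   Formalization: The time bound O(n) is replaced by O(n + e), with e the number of arcs leaving positional vertices beyond two per vertex (so O(n) when outdegrees are bounded), since with unbounded outdegree inspecting the arcs alone can take more than linear time. *)

(* Defs.v *)
From HB Require Import structures.
From mathcomp Require Import all_boot all_order all_algebra.
From mathcomp Require Import all_classical all_reals all_analysis.

Set Implicit Arguments.
Unset Strict Implicit.
Unset Printing Implicit Defensive.

Import Order.TTheory GRing.Theory Num.Theory.

Local Open Scope ring_scope.

(** * Simple stochastic games *)

Inductive kind := MAX | MIN | AVE | SINK.

Definition kind_code (k : kind) : nat :=
  match k with MAX => 0 | MIN => 1 | AVE => 2 | SINK => 3 end.

Definition code_kind (i : nat) : kind :=
  match i with 0 => MAX | 1 => MIN | 2 => AVE | _ => SINK end.

Lemma kind_codeK : cancel kind_code code_kind.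
Proof. by case. Qed.

HB.instance Definition _ := Countable.copy kind (can_type kind_codeK).

(** The field [sink_val] is only meaningful at sinks. *)
Record ssg (n : nat) := SSG {
  kind_of  : 'I_n -> kind;
  arc      : rel 'I_n;
  sink_val : 'I_n -> rat;
  sink_loop  : forall x, kind_of x = SINK -> forall y, arc x y = (y == x);
  sink_range : forall x, kind_of x = SINK -> 0 <= sink_val x <= 1;
  ave_outdeg : forall x, kind_of x = AVE -> #|arc x| = 2%N;
  pos_outdeg : forall x, kind_of x = MAX \/ kind_of x = MIN -> (0 < #|arc x|)%N
}.

Section Game.
Variables (n : nat) (G : ssg n).

Definition is_sink (x : 'I_n) : bool := kind_of G x == SINK.

Definition strongly_connected : Prop :=
  forall x y, ~~ is_sink x -> ~~ is_sink y ->
    connect [rel u v | [&& ~~ is_sink u, ~~ is_sink v & arc G u v]] x y.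

(** A directed cycle is a sequence [c] of pairwise distinct vertices, each with
    an arc to its successor [next c] in [c]; a loop is a cycle of length one. *)
Definition arc_on_cycle (x y : 'I_n) : Prop :=
  exists c : seq 'I_n, [/\ ucycle (arc G) c, x \in c & next c x = y].

(** The loops at sinks play no role here, as [x] is not a sink. *)
Definition almost_acyclic : Prop :=
  forall x, ~~ is_sink x ->
  forall y z, arc_on_cycle x y -> arc_on_cycle x z -> y = z.

(** Number of arcs leaving positional vertices beyond two per vertex; it is 0
    when all out-degrees are at most 2. *)
Definition excess_arcs : nat :=
  (\sum_(x | (kind_of G x == MAX) || (kind_of G x == MIN)) (#|arc G x| - 2))%N.

(** Strategies are total functions constrained on the vertices of the player
    ([MAX] or [MIN]) who uses them; the other values are never consulted. *)
Definition strategy (k : kind) : pred {ffun 'I_n -> 'I_n} :=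
  fun s => [forall x, (kind_of G x == k) ==> arc G x (s x)].

Definition step (sigma tau : {ffun 'I_n -> 'I_n}) (b : bool) (x : 'I_n) : 'I_n :=
  match kind_of G x with
  | MAX => sigma x
  | MIN => tau x
  | AVE => nth x (enum (arc G x)) b
  | SINK => x
  end.

Fixpoint play (sigma tau : {ffun 'I_n -> 'I_n}) (b : nat -> bool) (x : 'I_n)
    (t : nat) : 'I_n :=
  match t with
  | 0 => x
  | t'.+1 => step sigma tau (b t') (play sigma tau b x t')
  end.

Definition payoff (p : nat -> 'I_n) : rat :=
  match [pick s | is_sink s && `[< exists t, p t = s >]] with
  | Some s => sink_val G s
  | None => 0
  end.

End Game.

(** [coin] is a sequence of independent fair coin flips on [(T, P)]. *)
Definition fair_coins (R : realType) (d : measure_display)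
    (T : measurableType d) (P : probability T R) (coin : nat -> T -> bool) : Prop :=
  (forall t, measurable [set w : T | coin t w]%classic) /\
  (forall (t : nat) (b : nat -> bool),
     P [set w : T | forall i, (i < t)%N -> coin i w = b i]%classic
     = (2^-1 ^+ t)%:E).

Section Value.
Variables (R : realType) (d : measure_display) (T : measurableType d).
Variables (P : probability T R) (coin : nat -> T -> bool).
Variables (n : nat) (G : ssg n).

Definition val_st (sigma tau : {ffun 'I_n -> 'I_n}) (x : 'I_n) : R :=
  fine 'E_P[fun w => ratr (payoff G (play G sigma tau (coin^~ w) x)) : R].

(** Both players have a strategy and payoffs lie in [0, 1], so the neutral
    elements 0 and 1 do not affect these finite extrema. *)
Definition game_val (x : 'I_n) : R :=
  \big[Num.max/0]_(sigma | strategy G MAX sigma)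
    \big[Num.min/1]_(tau | strategy G MIN tau) val_st sigma tau x.

End Value.

(** * A random access machine over the rationals

    Programs are finite while-programs. The memory has arrays of natural numbers
    (indices) and arrays of rationals, each array being named by a constant.
    Every constant, memory access, arithmetic operation, comparison and boolean
    connective costs one time unit, so that the running time bounds in
    particular the number of arithmetic operations and comparisons.
    Rationals influence the control flow only through comparisons. *)

(** Subtraction of indices is truncated. *)
Inductive iexp :=
| IConst of nat
| ILoad of nat & iexp
| IAdd of iexp & iexp
| ISub of iexp & iexp.

(** Division by zero yields zero. *)
Inductive qexp :=
| QConst of rat
| QLoad of nat & iexp
| QAdd of qexp & qexp
| QSub of qexp & qexp
| QMul of qexp & qexp
| QDiv of qexp & qexp.

Inductive bexp :=
| BILe of iexp & iexp
| BQLe of qexp & qexp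
| BNot of bexp
| BAnd of bexp & bexp.

Inductive cmd :=
| Skip
| IStore of nat & iexp & iexp
| QStore of nat & iexp & qexp
| Seq of cmd & cmd
| If of bexp & cmd & cmd
| While of bexp & cmd.

(** [imem s a i] and [qmem s a i] are the [i]-th cells of the arrays named [a]. *)
Record state := State { imem : nat -> nat -> nat; qmem : nat -> nat -> rat }.

Definition upd (X : Type) (m : nat -> nat -> X) (a i : nat) (v : X) :
    nat -> nat -> X :=
  fun a' i' => if (a' == a) && (i' == i) then v else m a' i'.

Fixpoint ieval (s : state) (e : iexp) : nat :=
  match e with
  | IConst c => c
  | ILoad a e1 => imem s a (ieval s e1)
  | IAdd e1 e2 => (ieval s e1 + ieval s e2)%N
  | ISub e1 e2 => (ieval s e1 - ieval s e2)%N
  end.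

Fixpoint qeval (s : state) (e : qexp) : rat :=
  match e with
  | QConst c => c
  | QLoad a e1 => qmem s a (ieval s e1)
  | QAdd e1 e2 => qeval s e1 + qeval s e2
  | QSub e1 e2 => qeval s e1 - qeval s e2
  | QMul e1 e2 => qeval s e1 * qeval s e2
  | QDiv e1 e2 => qeval s e1 / qeval s e2
  end.

Fixpoint beval (s : state) (e : bexp) : bool :=
  match e with
  | BILe e1 e2 => (ieval s e1 <= ieval s e2)%N
  | BQLe e1 e2 => qeval s e1 <= qeval s e2
  | BNot e1 => ~~ beval s e1
  | BAnd e1 e2 => beval s e1 && beval s e2
  end.

Fixpoint icost (e : iexp) : nat :=
  match e with
  | IConst _ => 1
  | ILoad _ e1 => (icost e1).+1
  | IAdd e1 e2 | ISub e1 e2 => (icost e1 + icost e2).+1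
  end.

Fixpoint qcost (e : qexp) : nat :=
  match e with
  | QConst _ => 1
  | QLoad _ e1 => (icost e1).+1
  | QAdd e1 e2 | QSub e1 e2 | QMul e1 e2 | QDiv e1 e2 => (qcost e1 + qcost e2).+1
  end.

Fixpoint bcost (e : bexp) : nat :=
  match e with
  | BILe e1 e2 => (icost e1 + icost e2).+1
  | BQLe e1 e2 => (qcost e1 + qcost e2).+1
  | BNot e1 => (bcost e1).+1
  | BAnd e1 e2 => (bcost e1 + bcost e2).+1
  end.

(** [exec c s k s']: started in [s], [c] halts in [s'] after [k] time units. *)
Inductive exec : cmd -> state -> nat -> state -> Prop :=
| ExecSkip s : exec Skip s 0 s
| ExecIStore a e v s :
    exec (IStore a e v) s (icost e + icost v).+1
      (State (upd (imem s) a (ieval s e) (ieval s v)) (qmem s))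
| ExecQStore a e v s :
    exec (QStore a e v) s (icost e + qcost v).+1
      (State (imem s) (upd (qmem s) a (ieval s e) (qeval s v)))
| ExecSeq c1 c2 s k1 s1 k2 s2 :
    exec c1 s k1 s1 -> exec c2 s1 k2 s2 -> exec (Seq c1 c2) s (k1 + k2) s2
| ExecIf b c1 c2 s k s1 :
    exec (if beval s b then c1 else c2) s k s1 ->
    exec (If b c1 c2) s (bcost b + k) s1
| ExecWhileStop b c s :
    ~~ beval s b -> exec (While b c) s (bcost b) s
| ExecWhileLoop b c s k1 s1 k2 s2 :
    beval s b -> exec c s k1 s1 -> exec (While b c) s1 k2 s2 ->
    exec (While b c) s (bcost b + k1 + k2) s2.

(** * Input and output of the machine *)

Section Encoding.
Variables (n : nat) (G : ssg n) (adj : 'I_n -> seq 'I_n).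

(** The successors of each vertex are listed in an arbitrary order. *)
Definition adjacency_lists : Prop :=
  forall x, uniq (adj x) /\ adj x =i arc G x.

Definition adj_rows : seq (seq nat) :=
  [seq map (@nat_of_ord n) (adj x) | x <- enum 'I_n].

(** Integer arrays: 0 holds the number of vertices in cell 0; 1 holds the kinds;
    3 is the concatenation of the adjacency lists, in which the list of vertex
    [i] occupies the cells from [imem 2 i] (included) to [imem 2 i.+1] (excluded).
    Rational array 0 holds the values of the sinks. All other cells are 0. *)
Definition input : state := State
  (fun a i => match a with
     | 0 => if i == 0%N then n else 0%N
     | 1 => nth 0%N [seq kind_code (kind_of G x) | x <- enum 'I_n] i
     | 2 => if (i <= n)%N then sumn (take i (shape adj_rows)) else 0%N
     | 3 => nth 0%N (flatten adj_rows) i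
     | _ => 0%N
     end)
  (fun a i => match a with
     | 0 => nth 0 [seq if is_sink G x then sink_val G x else 0 | x <- enum 'I_n] i
     | _ => 0
     end).

End Encoding.

(** The answer for vertex [i] is read in cell [i] of rational array 1. *)
Definition output (s : state) (i : nat) : rat := qmem s 1 i.

(* Main.v *)
Require Import Defs.
From HB Require Import structures.
From mathcomp Require Import all_boot all_order all_algebra.
From mathcomp Require Import all_classical all_reals all_analysis.
From mathcomp Require Import measurable_realfun zify ring lra.
Import Defs.

(** In a strongly connected almost-acyclic game every inner vertex has at most one inner
    successor, so the inner vertices form a single cycle (or one vertex without a loop) and
    all other arcs lead to sinks.
    The value at a vertex is therefore a function of the value at the next vertex of the form
    [u |-> max l (min h (a u + b))], and such functions are closed under composition. Their
    composition around the cycle has a least fixed point with a closed form; it is the value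
    of the starting vertex, and one more tour backwards along the cycle gives the others.

    Leastness is what makes this the game value when the cycle has no average vertex and the
    fixed point is not unique. MIN achieves it by playing greedily, since the expected value
    of the current vertex never increases. MAX plays greedily too, but leaves the cycle
    whenever this is optimal: either some vertex of the cycle leaks to a sink with
    probability at least 1/2, and the play ends almost surely, or the value is 0. *)

Set Implicit Arguments.
Unset Strict Implicit.
Unset Printing Implicit Defensive.

Import Order.TTheory GRing.Theory Num.Theory.
Import numFieldNormedType.Exports.

Local Open Scope ring_scope.

(** * Expected payoffs *)

Lemma eq_play n (G : ssg n) sigma tau (b b' : nat -> bool) x t :
  (forall i, (i < t)%N -> b i = b' i) ->
  play G sigma tau b x t = play G sigma tau b' x t.
Proof.
elim: t => //= t IH eqb; rewrite eqb // IH // => i it.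
by apply: eqb; apply: ltnW.
Qed.

(** The transition operator of the Markov chain. Both coin outcomes are averaged at every vertex;
    away from average vertices they coincide. *)
Definition mean_step n (G : ssg n) sigma tau (h : 'I_n -> rat) (x : 'I_n) : rat :=
  (h (step G sigma tau false x) + h (step G sigma tau true x)) / 2.

(** The payoff of a play stopped at [x]; along a play it can only grow. *)
Definition sink_payoff n (G : ssg n) (x : 'I_n) : rat :=
  if is_sink G x then sink_val G x else 0.

Section Play.
Variables (n : nat) (G : ssg n) (sigma tau : {ffun 'I_n -> 'I_n}).

Lemma sink_payoff_ge0 x : 0 <= sink_payoff G x.
Proof.
rewrite /sink_payoff; case: ifP => // /eqP xS.
by case/andP: (sink_range xS).
Qed.

Lemma sink_payoff_le1 x : sink_payoff G x <= 1.
Proof.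
rewrite /sink_payoff; case: ifP => // /eqP xS.
by case/andP: (sink_range xS).
Qed.

Lemma step_sink b x : is_sink G x -> step G sigma tau b x = x.
Proof. by rewrite /is_sink /step => /eqP ->. Qed.

Lemma play_sink b x t t' : is_sink G (play G sigma tau b x t) -> (t <= t')%N ->
  play G sigma tau b x t' = play G sigma tau b x t.
Proof.
move=> xs /subnKC <-; elim: (t' - t)%N => [|j IH]; first by rewrite addn0.
by rewrite addnS /= IH step_sink.
Qed.

Lemma payoff_reached b x t : is_sink G (play G sigma tau b x t) ->
  payoff G (play G sigma tau b x) = sink_val G (play G sigma tau b x t).
Proof.
move=> xs; rewrite /payoff; case: pickP => [s /andP[ss /asboolP[t' e]]|].
  rewrite -e in ss *.
  by have [le|/ltnW le] := leqP t t'; rewrite (play_sink _ le).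
by move=> /(_ (play G sigma tau b x t)); rewrite xs /= => /asboolPn; case; exists t.
Qed.

Lemma payoff_never b x : (forall t, ~~ is_sink G (play G sigma tau b x t)) ->
  payoff G (play G sigma tau b x) = 0.
Proof.
move=> ns; rewrite /payoff; case: pickP => // s /andP[ss /asboolP[t e]].
by move: (ns t); rewrite e ss.
Qed.

Lemma sink_payoff_play_le b x t t' : (t <= t')%N ->
  sink_payoff G (play G sigma tau b x t) <= sink_payoff G (play G sigma tau b x t').
Proof.
move=> tt'; have [xs|nxs] := boolP (is_sink G (play G sigma tau b x t)).
  by rewrite (play_sink xs tt').
by rewrite {1}/sink_payoff (negbTE nxs) sink_payoff_ge0.
Qed.

Lemma mean_step_le (h h' : 'I_n -> rat) : (forall x, h x <= h' x) ->
  forall x, mean_step G sigma tau h x <= mean_step G sigma tau h' x.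
Proof. by move=> le x; rewrite ler_pM2r // lerD. Qed.

Lemma iter_mean_step_le (h h' : 'I_n -> rat) t : (forall x, h x <= h' x) ->
  forall x, iter t (mean_step G sigma tau) h x <= iter t (mean_step G sigma tau) h' x.
Proof. by move=> le; elim: t => //= t IH; exact: mean_step_le. Qed.

Lemma iter_mean_step_le1 (h : 'I_n -> rat) t : (forall x, h x <= 1) ->
  forall x, iter t (mean_step G sigma tau) h x <= 1.
Proof.
move=> le; elim: t => //= t IH x; apply: le_trans (mean_step_le IH _) _.
by rewrite /mean_step.
Qed.

End Play.

(** * The expected payoff as a limit of stopped payoffs *)

Section Expectation.
Variables (R : realType) (d : measure_display) (T : measurableType d).
Variables (P : probability T R) (coin : nat -> T -> bool).
Hypothesis fair : fair_coins P coin.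
Variables (n : nat) (G : ssg n) (sigma tau : {ffun 'I_n -> 'I_n}).

Local Notation X := (play G sigma tau).
Local Notation A := (mean_step G sigma tau).

Let prefix_event k (c : nat -> bool) :=
  [set w : T | forall i, (i < k)%N -> coin i w = c i]%classic.

Let measurable_coin t b : measurable [set w : T | coin t w = b]%classic.
Proof.
case: b; first exact: fair.1.
suff -> : [set w | coin t w = false]%classic = (~` [set w | coin t w])%classic.
  by apply: measurableC; exact: fair.1.
by apply/seteqP; split => w /=; [move=> -> | move=> /negP/negbTE].
Qed.

Let measurable_prefix k c : measurable (prefix_event k c).
Proof.
suff -> : prefix_event k c =
    (\bigcap_(i in [set i | (i < k)%N]) [set w | coin i w = c i])%classic.
  exact: bigcap_measurableType.
by apply/seteqP; split.
Qed.

Lemma measurable_play x t y : measurable [set w | X (coin^~ w) x t = y]%classic.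
Proof.
elim: t y => [|t IH] y /=.
  have [->|ne] := eqVneq x y.
    by rewrite (_ : [set _ | _] = setT)%classic //; apply/seteqP; split.
  rewrite (_ : [set _ | _] = set0)%classic //; apply/seteqP; split => // w /= e.
  by rewrite e eqxx in ne.
rewrite (_ : [set _ | _]%classic = (\bigcup_(zb in [set zb : 'I_n * bool | step G sigma tau zb.2 zb.1 = y])
  ([set w | X (coin^~ w) x t = zb.1] `&` [set w | coin t w = zb.2]))%classic); last first.
  apply/seteqP; split => w /=.
    by move=> <-; exists (X (coin^~ w) x t, coin t w).
  by case=> -[z b] /= <- [-> ->].
apply: fin_bigcup_measurable => [|[z b] _ /=]; last exact: measurableI.
exact: finite_finset.
Qed.

Lemma measurable_preimage_play (U : Type) (D : set T) (h : 'I_n -> U) (Y : set U) x t :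
  measurable D -> measurable (D `&` (fun w => h (X (coin^~ w) x t)) @^-1` Y)%classic.
Proof.
move=> mD; apply: measurableI => //.
rewrite (_ : _ @^-1` _ = \bigcup_(z in [set z : 'I_n | Y (h z)])
  [set w | X (coin^~ w) x t = z])%classic; last first.
  apply/seteqP; split => w /=; first by move=> ?; exists (X (coin^~ w) x t).
  by case=> z /= ? ->.
by apply: fin_bigcup_measurable => [|z _]; [exact: finite_finset | exact: measurable_play].
Qed.

Let force k b (c : nat -> bool) i := if i == k then b else c i.

(** A cylinder on [k] coins has mass [2^-k] and determines the play up to time [k]. Splitting it by
    the next coin halves the mass and accounts for one application of [mean_step]. *)
Let integral_prefix (h : 'I_n -> rat) (h0 : forall x, 0 <= h x) x j k c :
  (\int[P]_(w in prefix_event k c) (ratr (h (X (coin^~ w) x (k + j))) : R)%:E =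
  (2^-1 ^+ k * ratr (iter j A h (X c x k)))%:E)%E.
Proof.
elim: j k c => [|j IH] k c.
  rewrite addn0 /= (eq_integral (cst (ratr (h (X c x k)) : R)%:E)).
    by rewrite integral_cst // [RHS]EFinM [RHS]muleC -(fair.2 k c).
  move=> w; rewrite inE => wc; rewrite /cst; congr (ratr (h _))%:E.
  exact: eq_play.
have forceE b : X (force k b c) x k.+1 = step G sigma tau b (X c x k).
  rewrite /= {1}/force eqxx; congr step; apply: eq_play => i ik.
  by rewrite /force ltn_eqF.
have -> : prefix_event k c =
    (prefix_event k.+1 (force k false c) `|` prefix_event k.+1 (force k true c))%classic.
  apply/seteqP; split => w /=.
    move=> wc; case ck: (coin k w); [right|left] => i; rewrite ltnS leq_eqVlt /force;
      by case: eqVneq => [->|_ /= /wc].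
  by case=> wc i ik; have := wc i (ltnW ik); rewrite /force ltn_eqF.
rewrite ge0_integral_setU //.
- rewrite addnS -addSn !IH !forceE -EFinD -mulrDr; congr (_%:E).
  by rewrite iterS {2}/mean_step rmorphM rmorphD fmorphV /= ratr_nat exprSr -mulrA (mulrC 2^-1).
- move=> _ Y _; apply: (measurable_preimage_play (fun z => (ratr (h z))%:E)).
  exact: measurableU.
- by move=> w _; rewrite lee_fin ler0q.
- rewrite disj_set2E; apply/eqP/seteqP; split => // w /= [w0 w1].
  by move: (w0 k (ltnSn k)) (w1 k (ltnSn k)); rewrite /force eqxx => ->.
Qed.

Lemma integral_play (h : 'I_n -> rat) (h0 : forall x, 0 <= h x) x t :
  (\int[P]_w (ratr (h (X (coin^~ w) x t)) : R)%:E = (ratr (iter t A h x))%:E)%E.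
Proof.
have := integral_prefix h0 x t 0 xpredT; rewrite add0n expr0 mul1r /= => <-.
by congr integral; apply/seteqP; split.
Qed.

(** Along each play the stopped payoffs increase and are eventually equal to the payoff, so monotone
    convergence applies. *)
Lemma cvg_val_st x :
  (ratr (iter t A (sink_payoff G) x) @[t --> \oo] --> val_st P coin G sigma tau x)%classic.
Proof.
pose g t w : \bar R := (ratr (sink_payoff G (X (coin^~ w) x t)))%:E.
have g0 t w : setT w -> (0 <= g t w)%E by rewrite lee_fin ler0q sink_payoff_ge0.
have ndg w : setT w -> {homo g^~ w : a b / (a <= b)%N >-> (a <= b)%E}.
  by move=> _ a b ab; rewrite lee_fin ler_rat sink_payoff_play_le.
have mg t : measurable_fun setT (g t).
  move=> _ Y _.
  exact: (measurable_preimage_play (fun z => (ratr (sink_payoff G z))%:E)).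
have limg w : limn (g^~ w) = (ratr (payoff G (X (coin^~ w) x)))%:E.
  apply: cvg_lim => //.
  have [[t xs]|ns] := pselect (exists t, is_sink G (X (coin^~ w) x t)).
    apply: cvg_near_cst; exists t => // t' /= tt'.
    by rewrite /g (play_sink xs tt') /sink_payoff xs (payoff_reached xs).
  apply: cvg_near_cst; apply: nearW => t; rewrite /g payoff_never => [|t'].
    by rewrite /sink_payoff ifF //; apply/negP => xs; case: ns; exists t.
  by apply/negP => xs; apply: ns; exists t'.
have cv := cvg_monotone_convergence (mu := P) measurableT mg g0 ndg.
have intg t : (\int[P]_w g t w = (ratr (iter t A (sink_payoff G) x))%:E)%E.
  exact: integral_play (@sink_payoff_ge0 _ G) _ _.
rewrite (eq_cvg _ _ intg) in cv.
rewrite (eq_integral (fun w => (ratr (payoff G (X (coin^~ w) x)))%:E)) in cv; last first.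
  by move=> w _; rewrite limg.
rewrite /val_st unlock; apply: (@fine_cvg _ _ _ _ (fun t => (ratr (iter t A (sink_payoff G) x))%:E)).
(* [val_st] applies [fine], so the expectation must be shown finite: it lies in [0, 1]. *)
set I := (\int[P]_w _)%E in cv *; rewrite fineK // ge0_fin_numE.
  have <- := cvg_lim (@ereal_hausdorff R) cv.
  apply: le_lt_trans (ltry 1); apply: lime_le; first by apply/cvg_ex; exists I.
  by apply: nearW => t; rewrite lee_fin -[1](rmorph1 (@ratr R)) ler_rat iter_mean_step_le1 // => y;
    exact: sink_payoff_le1.
by apply: integral_ge0 => w _; rewrite -limg; apply: lime_ge;
  [apply: ereal_nondecreasing_is_cvgn; exact: ndg | apply: nearW => t; exact: g0].
Qed.

End Expectation.

(** * Optimality equations *)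

Section MeanStep.
Variables (n : nat) (G : ssg n) (sigma tau : {ffun 'I_n -> 'I_n}).

Local Notation A := (mean_step G sigma tau).

(** Iterating [mean_step] on this indicator gives the probability that no sink has been reached
    yet. *)
Definition alive (x : 'I_n) : rat := (~~ is_sink G x)%:R.

Lemma iter_mean_step_linear (a b : rat) (h h' : 'I_n -> rat) t x :
  iter t A (fun y => a * h y + b * h' y) x = a * iter t A h x + b * iter t A h' x.
Proof. by elim: t x => //= t IH x; rewrite /mean_step !IH; lra. Qed.

Lemma iter_mean_step_ge (h : 'I_n -> rat) t : (forall x, h x <= A h x) ->
  forall x, h x <= iter t A h x.
Proof.
move=> le; elim: t => //= t IH x; apply: le_trans (le x) _; exact: mean_step_le.
Qed.

Lemma iter_mean_step_homo (h : 'I_n -> rat) : (forall x, h x <= A h x) ->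
  forall x, {homo (fun t => iter t A h x) : s t / (s <= t)%N >-> s <= t}.
Proof.
move=> le x s t /subnKC <-; rewrite iterD.
by apply: iter_mean_step_le => y; exact: iter_mean_step_ge.
Qed.

Lemma sink_payoff_mean_step x : sink_payoff G x <= A (sink_payoff G) x.
Proof.
have [xs|nxs] := boolP (is_sink G x); last first.
  rewrite {1}/sink_payoff (negbTE nxs); apply: mulr_ge0 => //.
  by apply: addr_ge0; exact: sink_payoff_ge0.
by rewrite /mean_step !step_sink //; lra.
Qed.

Lemma alive_mean_step x : A alive x <= alive x.
Proof.
rewrite /mean_step /alive; have [xs|nxs] := boolP (is_sink G x).
  by rewrite !step_sink // xs mulr0n; lra.
by do 2 case: (is_sink G _); rewrite /= ?mulr1n ?mulr0n; lra.
Qed.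

Lemma iter_alive_le t x : iter t A alive x <= alive x.
Proof.
elim: t x => //= t IH x. by apply: le_trans (alive_mean_step x); exact: mean_step_le.
Qed.

(** Each block of [k] steps is survived with probability at most 1/2 from every vertex, and the
    bounds of successive blocks multiply. *)
Lemma iter_alive_geometric k : (forall x, iter k A alive x <= 2^-1) ->
  forall j x, iter (j * k) A alive x <= 2^-1 ^+ j.
Proof.
move=> half j x.
(* The factor [alive y] makes the bound vanish at sinks, so that one block is dominated pointwise by
   a multiple of [alive], to which the induction hypothesis applies by linearity. *)
suff le y : iter (j * k) A alive y <= 2^-1 ^+ j * alive y.
  apply: le_trans (le x) _; rewrite ler_piMr //.
  by rewrite /alive; case: is_sink.
elim: j y => [|j IH] y; first by rewrite mul1r.
rewrite mulSnr iterD.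
apply: (@le_trans _ _ (iter (j * k) A (fun y => 2^-1 * alive y + 0 * alive y) y)).
  apply: iter_mean_step_le => z; rewrite mul0r addr0.
  have [zs|nzs] := boolP (is_sink G z); last by rewrite /alive nzs mulr1.
  by apply: le_trans (iter_alive_le _ _) _; rewrite /alive zs mulr0.
by rewrite iter_mean_step_linear mul0r addr0 exprS -mulrA ler_wpM2l.
Qed.

End MeanStep.

(** * Bounds on the value of a pair of strategies *)

Section ValueBounds.
Variables (R : realType) (d : measure_display) (T : measurableType d).
Variables (P : probability T R) (coin : nat -> T -> bool).
Hypothesis fair : fair_coins P coin.
Variables (n : nat) (G : ssg n) (sigma tau : {ffun 'I_n -> 'I_n}).

Local Notation A := (mean_step G sigma tau).
Local Notation val := (val_st P coin G sigma tau).

(** Applying [mean_step] to a superharmonic [v] only lowers it, so all expected stopped payoffs stay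
    below [v], and so does their limit. *)
Lemma val_st_le (v : 'I_n -> rat) x :
  (forall y, sink_payoff G y <= v y) -> (forall y, A v y <= v y) -> val x <= ratr (v x).
Proof.
move=> gv Av; apply: (cvgr_to_le (@cvg_val_st _ _ _ _ _ fair _ G sigma tau x)).
apply: nearW => t; rewrite ler_rat.
apply: le_trans (iter_mean_step_le _ _ _ t gv x) _.
by elim: t x => //= t IH x; apply: le_trans (Av x); exact: mean_step_le.
Qed.

Lemma iter_sink_payoff_le_val t x : ratr (iter t A (sink_payoff G) x) <= val x.
Proof.
apply: (cvgr_to_ge (@cvg_val_st _ _ _ _ _ fair _ G sigma tau x)); exists t => // t' /= tt'.
rewrite ler_rat; apply: iter_mean_step_homo tt' => y; exact: sink_payoff_mean_step.
Qed.

(** A subharmonic [v] is at most the expected payoff stopped at time [t] plus the probability of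
    being alive then, and the latter tends to 0 geometrically. *)
Lemma val_st_ge (v : 'I_n -> rat) k x :
  (forall y, v y <= sink_payoff G y + alive G y) -> (forall y, v y <= A v y) ->
  (forall y, iter k A (alive G) y <= 2^-1) -> ratr (v x) <= val x.
Proof.
move=> vg vA half; apply/ler_addgt0Pr => e e0.
have [j _ /(_ j (leqnn j)) /= je] := near_infty_natSinv_expn_lt (PosNum e0).
apply: le_trans (lerD (iter_sink_payoff_le_val (j * k) x) (ltW je)).
have -> : 1 / 2 ^+ j = ratr (2^-1 ^+ j) :> R.
  by rewrite rmorphXn fmorphV /= ratr_nat exprVn mul1r.
rewrite -rmorphD ler_rat.
apply: le_trans (iter_mean_step_ge (j * k) vA x) _.
apply: (@le_trans _ _ (iter (j * k) A (fun y => 1 * sink_payoff G y + 1 * alive G y) x)).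
  by apply: iter_mean_step_le => y; rewrite !mul1r.
by rewrite iter_mean_step_linear !mul1r lerD2l iter_alive_geometric.
Qed.

(** For plays that stay on the cycle forever, where survival does not decay: the payoff stopped at
    time 0 is already a sufficient bound. *)
Lemma val_st_ge_stuck (v : 'I_n -> rat) x :
  (forall y, v y <= sink_payoff G y) -> ratr (v x) <= val x.
Proof.
move=> vg; apply: le_trans (iter_sink_payoff_le_val 0 x); by rewrite ler_rat.
Qed.

End ValueBounds.

(** * The cycle of inner vertices *)

Section Cycle.
Variables (n : nat) (G : ssg n).
Hypotheses (sc : strongly_connected G) (aa : almost_acyclic G).

(** At an inner [x] the default is taken only when all arcs lead to sinks; under strong connectivity
    [x] is then the only inner vertex, and is treated as a cycle of length one. *)
Definition next_vertex (x : 'I_n) : 'I_n :=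
  odflt x [pick y | arc G x y && ~~ is_sink G y].

(** A path back from [y] to [x] through inner vertices, freed of repetitions, closes the arc to a
    cycle. *)
Lemma arc_on_cycle_inner x y :
  ~~ is_sink G x -> ~~ is_sink G y -> arc G x y -> arc_on_cycle G x y.
Proof.
move=> xs ys xy; have /connectP[p yp] := sc ys xs.
case/shortenP: yp => q yq uq _ ex.
exists (y :: q); split.
- rewrite /ucycle uq andbT /= rcons_path -ex xy andbT.
  by apply: sub_path yq => u v /and3P[].
- by rewrite ex; exact: mem_last.
- by rewrite next_nth ex mem_last index_last // nth_default.
Qed.

Lemma inner_succ_uniq x y z : ~~ is_sink G x -> arc G x y -> arc G x z ->
  ~~ is_sink G y -> ~~ is_sink G z -> y = z.
Proof. by move=> xs xy xz ys zs; apply: (aa xs); exact: arc_on_cycle_inner. Qed.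

Lemma next_vertexE x y : ~~ is_sink G x -> arc G x y -> ~~ is_sink G y ->
  next_vertex x = y.
Proof.
move=> xs xy ys; rewrite /next_vertex; case: pickP => [z /andP[xz zs]|/(_ y)] /=.
  exact: (inner_succ_uniq xs).
by rewrite xy ys.
Qed.

Lemma next_vertex_inner x : ~~ is_sink G x -> ~~ is_sink G (next_vertex x).
Proof. by move=> xs; rewrite /next_vertex; case: pickP => [z /andP[]|] //=. Qed.

(** Every arc between inner vertices is a step of [next_vertex], so strong connectivity puts all
    inner vertices on one orbit. *)
Lemma fconnect_next x y : ~~ is_sink G x -> ~~ is_sink G y ->
  fconnect next_vertex x y.
Proof.
move=> xs ys; move: (sc xs ys); apply: connect_sub => u v /and3P[us vs uv].
by rewrite -(next_vertexE us uv vs) fconnect1.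
Qed.

(** Induction along the cycle, which passes through every inner vertex from any starting point. *)
Lemma all_reached (Q : 'I_n -> Prop) x : ~~ is_sink G x -> Q x ->
  (forall y, ~~ is_sink G y -> Q y -> Q (next_vertex y)) ->
  forall y, ~~ is_sink G y -> Q y.
Proof.
move=> xs Qx Qn y ys; have /iter_findex <- := fconnect_next xs ys.
suff [] : ~~ is_sink G (iter (findex next_vertex x y) next_vertex x) /\
  Q (iter (findex next_vertex x y) next_vertex x) by [].
elim: findex => //= i [is_ Qi]; split; [exact: next_vertex_inner | exact: Qn].
Qed.

End Cycle.

(** * Optimal strategies from the least prefixed point *)

Section Optimality.
Variables (n : nat) (G : ssg n).
Hypotheses (sc : strongly_connected G) (aa : almost_acyclic G).

Local Notation nx := (next_vertex G).

Lemma step_arc sigma tau b x : strategy G MAX sigma -> strategy G MIN tau ->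
  arc G x (step G sigma tau b x).
Proof.
move=> /forallP /(_ x) + /forallP /(_ x); rewrite /step.
case kx: (kind_of G x) => /=; rewrite ?eqxx //= => _ _; last by rewrite (sink_loop kx) eqxx.
have : nth x (enum (arc G x)) b \in enum (arc G x).
  by rewrite mem_nth // -cardE (ave_outdeg kx); case: b.
by rewrite mem_enum.
Qed.

(** The two successors are distinct, and at most one of them is inner. *)
Lemma ave_step_sink sigma tau x : kind_of G x = AVE ->
  exists b, is_sink G (step G sigma tau b x).
Proof.
move=> kx; apply: contrapT => ns.
have xs : ~~ is_sink G x by rewrite /is_sink kx.
have := enum_uniq (arc G x); have := cardE (arc G x); rewrite (ave_outdeg kx).
case E : (enum (arc G x)) => [|y [|z [|]]] //= _; rewrite inE andbT => /negP; apply.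
have inarc u : u \in enum (arc G x) -> arc G x u by rewrite mem_enum.
apply/eqP; apply: (inner_succ_uniq sc aa xs).
- by apply: inarc; rewrite E inE eqxx.
- by apply: inarc; rewrite E !inE eqxx orbT.
- by apply/negP => ys; apply: ns; exists false; rewrite /step kx E.
- by apply/negP => ys; apply: ns; exists true; rewrite /step kx E.
Qed.

Variable v : 'I_n -> rat.

(** Prefixed points of the Bellman operator. The value is the least one, because a play
    that never reaches a sink pays 0. *)
Record bellman_le (w : 'I_n -> rat) : Prop := BellmanLe {
  ble_sink x : is_sink G x -> w x = sink_val G x;
  ble_range x : 0 <= w x <= 1;
  ble_max x y : kind_of G x = MAX -> arc G x y -> w y <= w x;
  ble_min x : kind_of G x = MIN -> exists2 y, arc G x y & w y <= w x;
  ble_ave x : kind_of G x = AVE -> forall sigma tau, mean_step G sigma tau w x <= w x }.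

Hypothesis v_le : bellman_le v.
Hypothesis v_max : forall x, kind_of G x = MAX -> exists2 y, arc G x y & v x <= v y.
Hypothesis v_min : forall x y, kind_of G x = MIN -> arc G x y -> v x <= v y.
Hypothesis v_ave : forall x, kind_of G x = AVE -> forall sigma tau,
  v x <= mean_step G sigma tau v x.
Hypothesis v_least : forall w, bellman_le w -> forall x, v x <= w x.

(** Sinks come first among the optimal choices: a choice of equal value on the cycle could keep the
    play there forever, with payoff 0. *)
Definition max_opt : {ffun 'I_n -> 'I_n} := [ffun x =>
  if [pick s | [&& is_sink G s, arc G x s & v x <= v s]] is Some s then s
  else odflt x [pick y | arc G x y && (v x <= v y)]].

Definition min_opt : {ffun 'I_n -> 'I_n} :=
  [ffun x => odflt x [pick y | arc G x y && (v y <= v x)]].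

Lemma max_optP x : kind_of G x = MAX -> arc G x (max_opt x) /\ v x <= v (max_opt x).
Proof.
move=> kx; rewrite ffunE; case: pickP => [s /and3P[]|_] //.
case: pickP => [y /andP[]|] //=; have [y xy vy] := v_max kx.
by move=> /(_ y); rewrite xy vy.
Qed.

Lemma min_optP x : kind_of G x = MIN -> arc G x (min_opt x) /\ v (min_opt x) <= v x.
Proof.
move=> kx; rewrite ffunE; case: pickP => [y /andP[]|] //=.
by have [y xy vy] := ble_min v_le kx; move=> /(_ y); rewrite xy vy.
Qed.

Lemma strategy_max_opt : strategy G MAX max_opt.
Proof. by apply/forallP => x; apply/implyP => /eqP /max_optP[]. Qed.

Lemma strategy_min_opt : strategy G MIN min_opt.
Proof. by apply/forallP => x; apply/implyP => /eqP /min_optP[]. Qed.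

Lemma mean_step_const sigma tau x y :
  (forall b, step G sigma tau b x = y) -> mean_step G sigma tau v x = v y.
Proof. by move=> e; rewrite /mean_step !e; lra. Qed.

Lemma sink_payoff_le_v x : sink_payoff G x <= v x.
Proof.
rewrite /sink_payoff; case: ifP => [xs|_]; first by rewrite (ble_sink v_le).
by case/andP: (ble_range v_le x).
Qed.

Lemma mean_step_min_opt sigma x : strategy G MAX sigma ->
  mean_step G sigma min_opt v x <= v x.
Proof.
move=> /forallP /(_ x) smax; case kx: (kind_of G x).
- rewrite kx in smax; rewrite (@mean_step_const _ _ _ (sigma x)) => [|b]; last by rewrite /step kx.
  exact: (ble_max v_le).
- rewrite (@mean_step_const _ _ _ (min_opt x)) => [|b]; last by rewrite /step kx.
  by case: (min_optP kx).
- exact: (ble_ave v_le).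
- by rewrite (@mean_step_const _ _ _ x) => // b; rewrite /step kx.
Qed.

Lemma mean_step_max_opt tau x : strategy G MIN tau ->
  v x <= mean_step G max_opt tau v x.
Proof.
move=> /forallP /(_ x) smin; case kx: (kind_of G x).
- rewrite (@mean_step_const _ _ _ (max_opt x)) => [|b]; last by rewrite /step kx.
  by case: (max_optP kx).
- rewrite kx in smin; rewrite (@mean_step_const _ _ _ (tau x)) => [|b]; last by rewrite /step kx.
  exact: v_min.
- exact: v_ave.
- by rewrite (@mean_step_const _ _ _ x) => // b; rewrite /step kx.
Qed.

(** At such a vertex the next step ends the play with probability at least 1/2. *)
Definition leaky sigma tau x :=
  ~~ is_sink G x && [exists b, is_sink G (step G sigma tau b x)].

Lemma step_not_leaky sigma tau b x : strategy G MAX sigma -> strategy G MIN tau ->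
  ~~ is_sink G x -> ~~ leaky sigma tau x -> step G sigma tau b x = nx x.
Proof.
move=> smax smin xs; rewrite /leaky xs /= negb_exists => /forallP /(_ b) sb.
by apply/esym/next_vertexE => //; exact: step_arc.
Qed.

(** Up to the first leaky vertex the play is forced along the cycle; a leak before the given one
    only lowers the survival probability. *)
Lemma alive_leaky sigma tau x i : strategy G MAX sigma -> strategy G MIN tau ->
  ~~ is_sink G x -> leaky sigma tau (iter i nx x) ->
  iter i.+1 (mean_step G sigma tau) (alive G) x <= 2^-1.
Proof.
move=> smax smin.
have leak y : leaky sigma tau y -> mean_step G sigma tau (alive G) y <= 2^-1.
  case/andP => ys /existsP[b]; rewrite /mean_step /alive.
  by case: b => ->; case: is_sink => /=; rewrite ?mulr1n ?mulr0n; lra.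
elim: i x => [|i IH] x xs; first exact: leak.
rewrite iterSr => ln; have [lx|nlx] := boolP (leaky sigma tau x).
  rewrite iterSr; apply: le_trans (leak x lx).
  rewrite -iterSr iterS; apply: mean_step_le => y; exact: iter_alive_le.
rewrite iterS {1}/mean_step !step_not_leaky //.
by have := IH _ (next_vertex_inner xs) ln; lra.
Qed.

(** From any inner vertex the cycle leads to a leaky one in fewer than [n] steps, the step after
    that leaks, and survival only decreases up to time [n.+1]. *)
Lemma alive_half sigma tau : strategy G MAX sigma -> strategy G MIN tau ->
  (exists x, leaky sigma tau x) ->
  forall x, iter n.+1 (mean_step G sigma tau) (alive G) x <= 2^-1.
Proof.
move=> smax smin [y ly] x; have [xs|xs] := boolP (is_sink G x).
  by apply: (le_trans (@iter_alive_le _ G sigma tau _ x)); rewrite /alive xs.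
have ys : ~~ is_sink G y by case/andP: ly.
have xy := fconnect_next sc aa xs ys.
have le : (findex nx x y < n)%N.
  apply: leq_trans (findex_max xy) _; rewrite /order.
  by apply: leq_trans (max_card _) _; rewrite card_ord.
have := alive_leaky (i := findex nx x y) smax smin xs.
rewrite iter_findex // => /(_ ly); apply: le_trans.
rewrite -(subnKC (ltnW le : (_.+1 <= n.+1)%N)) addnC.
elim: (n.+1 - _)%N => // i IH; apply: le_trans IH.
rewrite addSn iterSr; apply: iter_mean_step_le => y'; exact: alive_mean_step.
Qed.

(** A play that never leaks forces every positional choice on the cycle, so [v] is
    constant there; were it positive, it could be lowered. *)
Lemma v_stuck tau : strategy G MIN tau -> (forall x, ~~ leaky max_opt tau x) ->
  forall x, v x <= sink_payoff G x.
Proof.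
move=> smin nl x; have smax := strategy_max_opt.
have nxE b y : ~~ is_sink G y -> step G max_opt tau b y = nx y.
  by move=> ys; exact: step_not_leaky.
rewrite /sink_payoff; case: ifPn => xs; first by rewrite (ble_sink v_le).
rewrite leNgt; apply/negP => vx0.
have no_ave y : ~~ is_sink G y -> kind_of G y = MAX \/ kind_of G y = MIN.
  move=> ys; case ky: (kind_of G y); [by left|by right| |by rewrite /is_sink ky in ys].
  have [b bs] := ave_step_sink max_opt tau ky.
  by move: (nl y); rewrite /leaky ys /= => /existsP; case; exists b.
(* [max_opt] prefers sinks, so it stays on the cycle only where every exit is strictly worse. *)
have no_exit y s : kind_of G y = MAX -> is_sink G s -> arc G y s -> v s < v y.
  move=> ky ss ys; rewrite ltNge; apply/negP => le.
  have nys : ~~ is_sink G y by rewrite /is_sink ky.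
  have := nxE true y nys; rewrite /step ky ffunE.
  case: pickP => [z /and3P[zs _ _] e|/(_ s)]; last by rewrite ss ys le.
  by move: (next_vertex_inner nys); rewrite -e zs.
have le_next y : ~~ is_sink G y -> v y <= v (nx y).
  move=> ys; rewrite -(nxE true y ys) /step; case: (no_ave y ys) => ky; rewrite ky.
    by case: (max_optP ky).
  apply: v_min => //; by move/forallP/(_ y): smin; rewrite ky.
(* [v] does not decrease along the cycle, and the cycle comes back, so [v] is constant on it. *)
have const y : ~~ is_sink G y -> v y = v x.
  move=> ys; apply/eqP; rewrite eq_le; apply/andP; split.
    apply: (all_reached sc aa (Q := fun z => v y <= v z) ys) => // z zs le.
    exact: le_trans le (le_next z zs).
  apply: (all_reached sc aa (Q := fun z => v x <= v z) xs) => // z zs le.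
  exact: le_trans le (le_next z zs).
(* The best sink to which MAX can leave, or 0; it is strictly below [v]. Lowering [v] to [c] on the
   cycle still gives a prefixed point, as MAX gains at most [c] by leaving and MIN can stay. This
   contradicts leastness. *)
pose c := \big[Num.max/0]_(s | is_sink G s && [exists y, (kind_of G y == MAX) && arc G y s]) sink_val G s.
have cx : c < v x.
  apply/bigmax_ltP; split => // s /andP[ss /existsP[y /andP[/eqP ky ys]]].
  by rewrite -(ble_sink v_le) // -(const y) ?no_exit // /is_sink ky.
have /v_least /(_ x) : bellman_le (fun y => if is_sink G y then sink_val G y else c).
  split=> [y -> //|y|y z ky yz|y ky|y ky].
  - case: ifP => [/eqP /sink_range //|_].
    rewrite bigmax_ge_id /=; apply: le_trans (ltW cx) _.
    by case/andP: (ble_range v_le x).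
  - rewrite {2}/is_sink ky /=; case: ifP => // zs; apply: le_bigmax_cond.
    by rewrite zs; apply/existsP; exists y; rewrite ky eqxx.
  - have ys : ~~ is_sink G y by rewrite /is_sink ky.
    exists (nx y); first by rewrite -(nxE true y ys) step_arc.
    by rewrite (negbTE (next_vertex_inner ys)) (negbTE ys).
  - by have := no_ave y; rewrite /is_sink ky => /(_ isT)[].
by rewrite (negbTE xs) leNgt cx.
Qed.

Variables (R : realType) (d : measure_display) (T : measurableType d).
Variables (P : probability T R) (coin : nat -> T -> bool).
Hypothesis fair : fair_coins P coin.

(** Either some vertex leaks against [tau] and survival decays, or none does and [v] is dominated by
    the sink payoffs. *)
Lemma max_opt_guarantees tau x : strategy G MIN tau ->
  ratr (v x) <= val_st P coin G max_opt tau x.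
Proof.
move=> smin; have smax := strategy_max_opt.
have [ex|nex] := pselect (exists y, leaky max_opt tau y).
  apply: (val_st_ge fair (k := n.+1)) => y; last exact: alive_half.
    rewrite /sink_payoff /alive; case: ifP => ys; rewrite ?addr0 ?add0r.
      by rewrite (ble_sink v_le).
    by case/andP: (ble_range v_le y).
  exact: mean_step_max_opt.
apply: (val_st_ge_stuck fair); apply: v_stuck smin _ => y.
by apply/negP => ly; apply: nex; exists y.
Qed.

Lemma min_opt_guarantees sigma x : strategy G MAX sigma ->
  val_st P coin G sigma min_opt x <= ratr (v x).
Proof.
move=> smax; apply: (val_st_le fair) => y; first exact: sink_payoff_le_v.
exact: mean_step_min_opt.
Qed.

(** [min_opt] caps every [sigma], [max_opt] is one candidate for the maximum, and the range of [v]
    takes care of the neutral elements 0 and 1. *)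
Lemma game_valE x : game_val P coin G x = ratr (v x).
Proof.
have /andP[v0 v1] := ble_range v_le x.
apply/eqP; rewrite eq_le; apply/andP; split.
  apply: bigmax_le => [|sigma smax]; first by rewrite ler0q.
  exact: bigmin_inf strategy_min_opt (min_opt_guarantees _ _).
apply: le_trans (le_bigmax_cond _ _ strategy_max_opt).
apply/bigmin_geP; split => [|tau smin]; last exact: max_opt_guarantees.
by rewrite -(rmorph1 (@ratr R)) ler_rat.
Qed.

End Optimality.

(** * Clamps *)

Record clamp := Clamp { slope : rat; intercept : rat; lower : rat; upper : rat }.

Definition clamp_eval (f : clamp) (u : rat) : rat :=
  Num.max (lower f) (Num.min (upper f) (slope f * u + intercept f)).

(** The identity on [0, 1] only, which is where all values lie. *)
Definition clamp_id := Clamp 1 0 0 1.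

Definition clamp_comp (f g : clamp) : clamp := Clamp (slope f * slope g)
  (slope f * intercept g + intercept f) (clamp_eval f (lower g)) (clamp_eval f (upper g)).

(** When [slope f = 1] the clamps below have [intercept f = 0], and [0 / 0 = 0] turns this
    into the lower bound, the least of many fixed points. *)
Definition clamp_fix (f : clamp) : rat :=
  Num.max (lower f) (Num.min (upper f) (intercept f / (1 - slope f))).

(** The affine part is nondecreasing and maps [0, 1] into itself; in particular slope 1 forces
    intercept 0. *)
Record clamp_wf (f : clamp) : Prop := ClampWf {
  slope_ge0 : 0 <= slope f; intercept_ge0 : 0 <= intercept f; slope_intercept : slope f + intercept f <= 1;
  lower_ge0 : 0 <= lower f; lower_upper : lower f <= upper f; upper_le1 : upper f <= 1 }.

Lemma clamp_eval_range f u : clamp_wf f -> 0 <= clamp_eval f u <= 1.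
Proof.
case=> _ _ _ l0 lu u1; rewrite /clamp_eval le_max l0 /= ge_max ge_min u1 /= andbT.
exact: le_trans lu u1.
Qed.

Lemma clamp_eval_le f u u' : clamp_wf f -> u <= u' -> clamp_eval f u <= clamp_eval f u'.
Proof.
move=> fwf uu'; apply: le_max2 => //; apply: le_min2 => //.
by rewrite lerD2r; apply: ler_wpM2l => //; exact: slope_ge0.
Qed.

(** The affine part of [f] is nondecreasing and so commutes with max and min; the leftover minimum
    with [lower f] is absorbed by [lower f]. *)
Lemma clamp_eval_comp f g u : clamp_wf f ->
  clamp_eval (clamp_comp f g) u = clamp_eval f (clamp_eval g u).
Proof.
move=> fwf; have f0 := slope_ge0 fwf.
have e : slope f * slope g * u + (slope f * intercept g + intercept f) =
  slope f * (slope g * u + intercept g) + intercept f by ring.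
rewrite [LHS]/clamp_eval /= {}e /clamp_eval; move: (slope g * u + intercept g) => t.
rewrite (maxr_pMr _ _ f0) (minr_pMr _ _ f0) addr_maxl addr_minl min_maxr minA min_maxl.
by rewrite -maxA [X in Num.max _ X]maxCA maxA (max_l (_ : Num.min _ _ <= _)) // ge_min lexx.
Qed.

Lemma clamp_id_wf : clamp_wf clamp_id.
Proof. by split. Qed.

Lemma clamp_comp_wf f g : clamp_wf f -> clamp_wf g -> clamp_wf (clamp_comp f g).
Proof.
move=> fwf gwf; have /andP[l0 _] := clamp_eval_range (lower g) fwf.
have /andP[_ u1] := clamp_eval_range (upper g) fwf.
case: (fwf) => a0 b0 ab _ _ _; case: (gwf) => a0' b0' ab' _ lu' _.
by split => //=; [nra|nra|nra|exact: clamp_eval_le].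
Qed.

Lemma clamp_fix_range f : clamp_wf f -> 0 <= clamp_fix f <= 1.
Proof.
case=> _ _ _ l0 lu u1; rewrite /clamp_fix le_max l0 /= ge_max ge_min u1 /= andbT.
exact: le_trans lu u1.
Qed.

(** With slope below 1 the affine part moves every point towards its own fixed point [q], so a bound
    that cuts [q] off is itself fixed. With slope 1 the affine part is the identity. *)
Lemma clamp_fixP f : clamp_wf f -> clamp_eval f (clamp_fix f) = clamp_fix f.
Proof.
case=> a0 b0 ab l0 lu u1; rewrite /clamp_eval /clamp_fix.
have [a1|a1] := eqVneq (slope f) 1.
  have -> : intercept f = 0 by lra.
  rewrite a1 mul0r mul1r addr0 (min_r (_ : 0 <= upper f)); last by lra.
  by rewrite (max_l l0) (min_r lu) maxxx.
set q := intercept f / _; have aq : slope f * q + intercept f = q.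
  by rewrite /q; field; lra.
have {}a1 : slope f < 1 by rewrite lt_neqAle a1; lra.
case: (leP (upper f) q) => uq.
  by rewrite (max_r lu) min_l ?max_r //; nra.
case: (leP (lower f) q) => lq; first by rewrite aq (min_r (ltW uq)) max_r.
by rewrite max_l // ge_min; apply/orP; right; nra.
Qed.

(** With slope below 1, a prefixed point of the affine part lies above its fixed point; with slope 1
    the quotient is 0, which is below [u]. *)
Lemma clamp_fix_le f u : clamp_wf f -> 0 <= u -> clamp_eval f u <= u -> clamp_fix f <= u.
Proof.
case=> a0 b0 ab l0 lu u1 u0; rewrite /clamp_eval /clamp_fix !ge_max !ge_min.
move=> /andP[-> /= /orP[->//|au]]; apply/orP; right.
have [a1|a1] := eqVneq (slope f) 1; first by rewrite a1 subrr invr0 mulr0.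
have {}a1 : slope f < 1 by rewrite lt_neqAle a1; lra.
by rewrite ler_pdivrMr; lra.
Qed.

Section ClampSequence.
Variables (I : eqType) (g : I -> clamp).

(** The head is applied last: a vertex takes its value from the one that follows it. *)
Definition comp_clamps (s : seq I) : clamp :=
  foldr (fun x => clamp_comp (g x)) clamp_id s.

Definition eval_clamps (u : rat) (s : seq I) : rat :=
  foldr (fun x => clamp_eval (g x)) u s.

Lemma comp_clamps_wf s : {in s, forall x, clamp_wf (g x)} -> clamp_wf (comp_clamps s).
Proof.
elim: s => [|x s IH] gwf /=; first exact: clamp_id_wf.
apply: clamp_comp_wf; first by apply: gwf; exact: mem_head.
by apply: IH => y ys; apply: gwf; rewrite inE ys orbT.
Qed.

Lemma eval_comp_clamps s u : {in s, forall x, clamp_wf (g x)} -> 0 <= u <= 1 ->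
  clamp_eval (comp_clamps s) u = eval_clamps u s.
Proof.
move=> + u01; elim: s => [|x s IH] gwf /=.
  (* On the empty list, [clamp_id] fixes [u] because [u] lies in [0, 1]. *)
  by rewrite /clamp_eval /= mul1r addr0 min_r ?max_r; lra.
rewrite clamp_eval_comp; last by apply: gwf; exact: mem_head.
by rewrite IH // => y ys; apply: gwf; rewrite inE ys orbT.
Qed.

Lemma eval_clamps_le s u u' : {in s, forall x, clamp_wf (g x)} -> u <= u' ->
  eval_clamps u s <= eval_clamps u' s.
Proof.
move=> + uu'; elim: s => [|x s IH] gwf //=.
apply: clamp_eval_le; first by apply: gwf; exact: mem_head.
by apply: IH => y ys; apply: gwf; rewrite inE ys orbT.
Qed.

End ClampSequence.

(** * The clamp of a vertex *)

Section VertexClamp.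
Variables (n : nat) (G : ssg n) (adj : 'I_n -> seq 'I_n).

(** Before any arc is read: the empty maximum 0, the empty minimum 1, the empty sum 0. *)
Definition clamp_init (k : kind) := Clamp 0 (k == MIN)%:R 0 1.

(** At a positional vertex a sink tightens a bound, and an inner successor makes the affine part the
    identity, its argument being the value at the next vertex of the cycle. At an average vertex
    each arc adds one half of its target. *)
Definition clamp_arc (k : kind) (f : clamp) (y : 'I_n) : clamp :=
  let s := sink_val G y in
  match k, is_sink G y with
  | MAX, true => Clamp (slope f) (intercept f) (Num.max (lower f) s) (upper f)
  | MAX, false => Clamp 1 (intercept f) (lower f) (upper f)
  | MIN, true => Clamp (slope f) (intercept f) (lower f) (Num.min s (upper f))
  | MIN, false => Clamp 1 0 (lower f) (upper f)
  | _, true => Clamp (slope f) (intercept f + s / 2) (lower f) (upper f)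
  | _, false => Clamp (slope f + 1 / 2) (intercept f) (lower f) (upper f)
  end.

Definition clamp_arcs (k : kind) (ys : seq 'I_n) := foldl (clamp_arc k) (clamp_init k) ys.

Definition vertex_clamp (x : 'I_n) : clamp := clamp_arcs (kind_of G x) (adj x).

Let arc_val (u : rat) (y : 'I_n) := if is_sink G y then sink_val G y else u.

Lemma sink_val_range y : is_sink G y -> 0 <= sink_val G y <= 1.
Proof. by move=> /eqP; exact: sink_range. Qed.

Lemma arc_val_range u y : 0 <= u <= 1 -> 0 <= arc_val u y <= 1.
Proof. by move=> u01; rewrite /arc_val; case: ifP => // /sink_val_range. Qed.

(** Each arc replaces [m] by its maximum with the value along the arc, starting from 0; the
    alternative [m <= 0] covers this initial value. *)
Lemma clamp_arcs_max u ys : 0 <= u <= 1 -> let f := clamp_arcs MAX ys in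
  let m := Num.max (lower f) (slope f * u) in
  [/\ 0 <= slope f <= 1, intercept f = 0, 0 <= lower f <= 1 & upper f = 1] /\
  {in ys, forall y, arc_val u y <= m} /\ (m <= 0 \/ exists2 y, y \in ys & m <= arc_val u y).
Proof.
move=> u01; rewrite /clamp_arcs; elim/last_ind: ys => [|ys y].
  by split => //=; split => //; left; rewrite mul0r maxxx.
rewrite foldl_rcons /=; set f := foldl _ _ _; set m := Num.max _ (slope f * u).
move=> [[a01 b0 l01 h1] [ub att]]; have y01 := arc_val_range y u01.
suff [wf' e] : [/\ 0 <= slope (clamp_arc MAX f y) <= 1, intercept (clamp_arc MAX f y) = 0,
    0 <= lower (clamp_arc MAX f y) <= 1 & upper (clamp_arc MAX f y) = 1] /\
    Num.max (lower (clamp_arc MAX f y)) (slope (clamp_arc MAX f y) * u) =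
    Num.max m (arc_val u y).
  split => //; rewrite e; split => [z|].
    rewrite mem_rcons inE le_max => /predU1P[->|/ub ->//]; by rewrite lexx orbT.
  case: (leP m (arc_val u y)) => my; first by right; exists y; rewrite ?mem_rcons ?mem_head.
  by case: att => [|[z zys zm]]; [left|right; exists z => //; rewrite mem_rcons inE zys orbT].
rewrite /clamp_arc /m /arc_val /=; case: ifP => [/sink_val_range s01|_] /=.
  by split; [split => //; rewrite le_max ge_max; case/andP: s01 => -> ->; case/andP: l01 => -> -> | rewrite maxAC].
(* The old slope times [u] is at most [u], so the new identity part absorbs it. *)
split=> //; rewrite mul1r -maxA; congr Num.max; rewrite max_r //.
by rewrite ler_piMl //; lra.
Qed.

(** Dual to the maximum, with [m] starting at 1. The first inner successor turns the initial
    constant 1 into the identity, hence the two possible affine parts. *)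
Lemma clamp_arcs_min u ys : 0 <= u <= 1 -> let f := clamp_arcs MIN ys in
  let m := Num.min (upper f) (slope f * u + intercept f) in
  [/\ slope f = 0 /\ intercept f = 1 \/ slope f = 1 /\ intercept f = 0, lower f = 0 & 0 <= upper f <= 1] /\
  {in ys, forall y, m <= arc_val u y} /\ (1 <= m \/ exists2 y, y \in ys & arc_val u y <= m).
Proof.
move=> u01; rewrite /clamp_arcs; elim/last_ind: ys => [|ys y].
  by split => //=; split => //; [left | left; rewrite mul0r add0r minxx].
rewrite foldl_rcons /=; set f := foldl _ _ _; set m := Num.min _ (slope f * u + _).
move=> [[ab l0 h01] [lb att]]; have y01 := arc_val_range y u01.
suff [wf' e] : [/\ slope (clamp_arc MIN f y) = 0 /\ intercept (clamp_arc MIN f y) = 1 \/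
      slope (clamp_arc MIN f y) = 1 /\ intercept (clamp_arc MIN f y) = 0,
    lower (clamp_arc MIN f y) = 0 & 0 <= upper (clamp_arc MIN f y) <= 1] /\
    Num.min (upper (clamp_arc MIN f y))
      (slope (clamp_arc MIN f y) * u + intercept (clamp_arc MIN f y)) =
    Num.min m (arc_val u y).
  split => //; rewrite e; split => [z|].
    rewrite mem_rcons inE ge_min => /predU1P[->|/lb ->//]; by rewrite lexx orbT.
  case: (leP m (arc_val u y)) => my; last by right; exists y; rewrite ?mem_rcons ?mem_head.
  by case: att => [|[z zys zm]]; [left|right; exists z => //; rewrite mem_rcons inE zys orbT].
rewrite /clamp_arc /m /arc_val /=; case: ifP => [/sink_val_range s01|_] /=.
  by split; [split => //; rewrite le_min ge_min; case/andP: s01 => -> ->; case/andP: h01 => -> _ | rewrite [RHS]minC minA].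
split; first by split => //; right.
by rewrite mul1r addr0 -minA; congr Num.min; case: ab => -[-> ->]; rewrite min_r //; lra.
Qed.

(** Each arc adds at most 1/2 to [slope f + intercept f], which therefore stays below 1 at
    out-degree 2. *)
Lemma clamp_arcs_ave u ys : 0 <= u <= 1 -> let f := clamp_arcs AVE ys in
  [/\ 0 <= slope f, 0 <= intercept f, slope f + intercept f <= (size ys)%:R / 2, lower f = 0 & upper f = 1] /\
  slope f * u + intercept f = (\sum_(y <- ys) arc_val u y) / 2.
Proof.
move=> u01; rewrite /clamp_arcs; elim/last_ind: ys => [|ys y].
  by rewrite big_nil /= mulr0n !mul0r addr0.
rewrite foldl_rcons /=; set f := foldl _ _ _; rewrite -cats1 big_cat big_seq1 size_cat /= natrD.
move=> [[a0 b0 ab l0 h1] e]; rewrite !mulrDl -e /clamp_arc /arc_val /=.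
by case: ifP => [/sink_val_range s01|_] /=; do ?split => //; lra.
Qed.

Lemma clamp_eval_max u ys : 0 <= u <= 1 -> let f := clamp_arcs MAX ys in
  clamp_eval f u = Num.max (lower f) (slope f * u).
Proof.
move=> u01; have [[a01 b0 l01 h1] _] := clamp_arcs_max ys u01.
rewrite /= /clamp_eval b0 h1 addr0 min_r //; nra.
Qed.

Lemma clamp_eval_min u ys : 0 <= u <= 1 -> let f := clamp_arcs MIN ys in
  clamp_eval f u = Num.min (upper f) (slope f * u + intercept f).
Proof.
move=> u01; have [[ab l0 h01] _] := clamp_arcs_min ys u01.
rewrite /= /clamp_eval l0 max_r // le_min; case: ab => -[-> ->]; lra.
Qed.

Hypothesis adjP : adjacency_lists G adj.

Lemma mem_adj x y : (y \in adj x) = arc G x y.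
Proof. by case: (adjP x) => _ ->. Qed.

Lemma perm_adj x : perm_eq (adj x) (enum (arc G x)).
Proof.
have [ua am] := adjP x; apply: uniq_perm => //; first exact: enum_uniq.
by move=> y; rewrite am mem_enum.
Qed.

Lemma size_adj x : size (adj x) = #|arc G x|.
Proof. by rewrite (perm_size (perm_adj x)) cardE. Qed.

Lemma vertex_clamp_wf x : ~~ is_sink G x -> clamp_wf (vertex_clamp x).
Proof.
have u01 : 0 <= (0 : rat) <= 1 by [].
rewrite /vertex_clamp /is_sink; case kx: (kind_of G x) => // _.
- have [[a01 b0 l01 h1] _] := clamp_arcs_max (adj x) u01.
  by split; rewrite ?b0 ?h1; lra.
- have [[ab l0 h01] _] := clamp_arcs_min (adj x) u01.
  by split; rewrite ?l0; lra.
- have [[a0 b0 + l0 h1] _] := clamp_arcs_ave (adj x) u01.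
  by rewrite size_adj (ave_outdeg kx) => ab; split; rewrite ?l0 ?h1; lra.
Qed.

Section VertexEquation.
Variables (x : 'I_n) (w : 'I_n -> rat).
Hypothesis xs : ~~ is_sink G x.
Hypothesis w01 : forall y, 0 <= w y <= 1.
Hypothesis w_sink : forall y, is_sink G y -> w y = sink_val G y.
Hypotheses (sc : strongly_connected G) (aa : almost_acyclic G).

Let u := w (next_vertex G x).
Local Notation e := (clamp_eval (vertex_clamp x) u).

Let arc_valE y : arc G x y -> arc_val u y = w y.
Proof.
rewrite /arc_val /u => xy; case: ifPn => [/w_sink //|ys].
by rewrite (next_vertexE sc aa xs xy ys).
Qed.

Let adj0 : (0 < #|arc G x|)%N.
Proof.
move: xs; rewrite /is_sink; case kx: (kind_of G x) => // _.
- by apply: pos_outdeg; left.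
- by apply: pos_outdeg; right.
- by rewrite (ave_outdeg kx).
Qed.

Lemma vertex_clamp_max : kind_of G x = MAX ->
  (forall y, arc G x y -> w y <= e) /\ exists2 y, arc G x y & e <= w y.
Proof.
move=> kx; rewrite /vertex_clamp kx clamp_eval_max; last exact: w01.
have [_ [ub att]] := clamp_arcs_max (adj x) (w01 (next_vertex G x)).
split=> [y xy|]; first by rewrite -arc_valE // ub // mem_adj.
case: att => [le0|[y xy ye]].
  (* If the maximum is at most 0, any successor reaches it, and there is at least one. *)
  have /card_gt0P[y xy] := adj0; exists y => //; apply: le_trans le0 _.
  by case/andP: (w01 y).
by rewrite mem_adj in xy; exists y => //; rewrite -arc_valE.
Qed.

Lemma vertex_clamp_min : kind_of G x = MIN ->
  (forall y, arc G x y -> e <= w y) /\ exists2 y, arc G x y & w y <= e.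
Proof.
move=> kx; rewrite /vertex_clamp kx clamp_eval_min; last exact: w01.
have [_ [lb att]] := clamp_arcs_min (adj x) (w01 (next_vertex G x)).
split=> [y xy|]; first by rewrite -arc_valE // lb // mem_adj.
case: att => [le1|[y xy ye]].
  have /card_gt0P[y xy] := adj0; exists y => //; apply: le_trans le1.
  by case/andP: (w01 y).
by rewrite mem_adj in xy; exists y => //; rewrite -arc_valE.
Qed.

Lemma vertex_clamp_ave sigma tau : kind_of G x = AVE -> e = mean_step G sigma tau w x.
Proof.
move=> kx; have [[a0 b0 + l0 h1]] := clamp_arcs_ave (adj x) (w01 (next_vertex G x)).
rewrite size_adj (ave_outdeg kx) /clamp_eval /vertex_clamp kx l0 h1 -/u => ab es.
have u01 : 0 <= u <= 1 := w01 _.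
rewrite min_r ?max_r; [|nra|nra]; rewrite {}es.
rewrite (eq_big_seq w) => [|y]; last by rewrite mem_adj; exact: arc_valE.
(* [step] reads the successors in the order of [enum], the clamp in the order of [adj]; the sum is
   the same. *)
rewrite (perm_big _ (perm_adj x)) /= /mean_step /step kx.
have := cardE (arc G x); rewrite (ave_outdeg kx).
by case: (enum _) => [|y [|z []]] //= _; rewrite !big_cons big_nil addr0.
Qed.

End VertexEquation.

(** * Values around the cycle *)

Section CycleValue.
Hypotheses (sc : strongly_connected G) (aa : almost_acyclic G).
Variable x0 : 'I_n.
(** An implication, so that games consisting of sinks only are included. *)
Hypothesis x0_inner : forall x, ~~ is_sink G x -> ~~ is_sink G x0.

Local Notation nx := (next_vertex G).
Local Notation m := #|[pred x | ~~ is_sink G x]|.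

Definition cycle_fix : rat := clamp_fix (comp_clamps vertex_clamp (traject nx x0 m)).

(** [m - findex nx x0 x] is the number of steps from [x] until the tour is back at [x0]; at [x0]
    itself this is a full tour. *)
Definition cycle_value (x : 'I_n) : rat :=
  if is_sink G x then sink_val G x
  else eval_clamps vertex_clamp cycle_fix (traject nx x (m - findex nx x0 x)).

Lemma traject_inner x k : ~~ is_sink G x -> {in traject nx x k, forall y, ~~ is_sink G y}.
Proof.
move=> xs y /trajectP[i _ ->]; elim: i => //= i; exact: next_vertex_inner.
Qed.

Lemma traject_wf x k : ~~ is_sink G x ->
  {in traject nx x k, forall y, clamp_wf (vertex_clamp y)}.
Proof. by move=> xs y yt; apply: vertex_clamp_wf; exact: traject_inner yt. Qed.

(** The orbit of an inner vertex runs through all inner vertices and never enters a sink. *)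
Lemma order_inner x : ~~ is_sink G x -> order nx x = m.
Proof.
move=> xs; apply: eq_card => y; rewrite !inE.
have [ys|ys] := boolP (is_sink G y); last exact: fconnect_next.
apply/negP => /iter_findex e; move: ys; rewrite -e; apply/negP.
by elim: findex => //= i; exact: next_vertex_inner.
Qed.

Lemma iter_order_inner x : ~~ is_sink G x -> iter m nx x = x.
Proof.
move=> xs; rewrite -(order_inner xs).
have fc : fcycle nx (orbit nx x).
  by rewrite -fconnect_f; apply: fconnect_next => //; exact: next_vertex_inner.
by apply: (iter_order_cycle fc); exact: in_orbit.
Qed.

Lemma findex_inner x : ~~ is_sink G x -> (findex nx x0 x < m)%N.
Proof.
move=> xs; have x0s := x0_inner xs.
by rewrite -(order_inner x0s); apply: findex_max; exact: fconnect_next.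
Qed.

Lemma iter_findex_inner x : ~~ is_sink G x -> iter (findex nx x0 x) nx x0 = x.
Proof. by move=> xs; apply/iter_findex/fconnect_next => //; exact: x0_inner xs. Qed.

Lemma cycle_fix_range : ~~ is_sink G x0 -> 0 <= cycle_fix <= 1.
Proof. by move=> x0s; apply/clamp_fix_range/comp_clamps_wf/traject_wf. Qed.

Lemma cycle_value_range x : 0 <= cycle_value x <= 1.
Proof.
rewrite /cycle_value; case: ifPn => [/sink_val_range //|xs].
have := findex_inner xs; rewrite -subn_gt0; case: (_ - _)%N => //= k _.
by apply: clamp_eval_range; exact: vertex_clamp_wf.
Qed.

Lemma cycle_value_sink x : is_sink G x -> cycle_value x = sink_val G x.
Proof. by rewrite /cycle_value => ->. Qed.

(** Immediate from the definition except at the vertex before [x0]: there the tour closes, and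
    [cycle_fix] being a fixed point of the whole composition is what is needed. *)
Lemma cycle_value_next x : ~~ is_sink G x ->
  cycle_value x = clamp_eval (vertex_clamp x) (cycle_value (nx x)).
Proof.
move=> xs; have x0s := x0_inner xs.
have im := findex_inner xs; have ix := iter_findex_inner xs.
rewrite /cycle_value (negbTE xs) (negbTE (next_vertex_inner xs)) -[in LHS](subnSK im) /=.
congr clamp_eval; move: im; rewrite leq_eqVlt => /predU1P[im|im].
  have -> : nx x = x0 by rewrite -{1}ix -iterS im iter_order_inner.
  rewrite im subnn findex0 subn0 /= -eval_comp_clamps.
  - by rewrite clamp_fixP //; apply/comp_clamps_wf/traject_wf.
  - exact: traject_wf.
  - exact: cycle_fix_range.
have -> // : findex nx x0 (nx x) = (findex nx x0 x).+1.
by rewrite -{1}ix -iterS findex_iter // (order_inner x0s).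
Qed.

Lemma bellman_le_clamp w x : bellman_le G w -> ~~ is_sink G x ->
  clamp_eval (vertex_clamp x) (w (nx x)) <= w x.
Proof.
case=> wS w01 wM wm wa xs; case kx: (kind_of G x).
- have [_ [y xy]] := vertex_clamp_max xs w01 wS sc aa kx.
  by move/le_trans; apply; exact: wM.
- have [lb _] := vertex_clamp_min xs w01 wS sc aa kx.
  by have [y xy] := wm x kx; apply: le_trans; exact: lb.
(* Any two functions serve as strategies, since an average step ignores them. *)
- rewrite (vertex_clamp_ave xs w01 wS sc aa [ffun=> x] [ffun=> x] kx); exact: wa.
- by rewrite /is_sink kx in xs.
Qed.

Lemma eval_clamps_bellman_le w x k : bellman_le G w -> ~~ is_sink G x ->
  eval_clamps vertex_clamp (w (iter k nx x)) (traject nx x k) <= w x.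
Proof.
move=> wle; elim: k x => [|k IH] x xs //; rewrite iterSr /=.
apply: le_trans (bellman_le_clamp wle xs); apply: clamp_eval_le.
  exact: vertex_clamp_wf.
by apply: IH; exact: next_vertex_inner.
Qed.

(** One tour shows that [w x0] is a prefixed point of the composed clamp, hence at least
    [cycle_fix]; monotonicity carries this to the other vertices. *)
Lemma cycle_value_least w : bellman_le G w -> forall x, cycle_value x <= w x.
Proof.
move=> wle x; rewrite /cycle_value; case: ifPn => [xs|xs]; first by rewrite (ble_sink wle).
have x0s := x0_inner xs.
have fix_le : cycle_fix <= w x0.
  have w01 := ble_range wle x0.
  apply: clamp_fix_le; first by apply/comp_clamps_wf/traject_wf.
    by case/andP: w01.
  rewrite eval_comp_clamps //; last exact: traject_wf.
  by rewrite -{1}(iter_order_inner x0s); exact: eval_clamps_bellman_le.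
apply: le_trans (eval_clamps_bellman_le (m - findex nx x0 x) wle xs).
apply: eval_clamps_le; first exact: traject_wf.
rewrite -{2}(iter_findex_inner xs) -iterD subnK ?iter_order_inner //.
exact/ltnW/findex_inner.
Qed.

Lemma cycle_value_bellman : bellman_le G cycle_value.
Proof.
have c01 := cycle_value_range; have cS := cycle_value_sink.
split=> // [x y kx xy|x kx|x kx sigma tau];
  have xs : ~~ is_sink G x by rewrite /is_sink kx.
- rewrite (cycle_value_next xs).
  by have [ub _] := vertex_clamp_max xs c01 cS sc aa kx; exact: ub.
- rewrite (cycle_value_next xs).
  by have [_ att] := vertex_clamp_min xs c01 cS sc aa kx.
- by rewrite [leRHS](cycle_value_next xs) (vertex_clamp_ave xs c01 cS sc aa sigma tau kx).
Qed.

Lemma game_val_cycle_value (R : realType) (d : measure_display) (T : measurableType d)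
    (P : probability T R) (coin : nat -> T -> bool) x :
  fair_coins P coin -> game_val P coin G x = ratr (cycle_value x).
Proof.
have c01 := cycle_value_range; have cS := cycle_value_sink.
move=> fair; apply: (game_valE sc aa cycle_value_bellman) => //.
- move=> {}x kx; have xs : ~~ is_sink G x by rewrite /is_sink kx.
  have [_ att] := vertex_clamp_max xs c01 cS sc aa kx.
  by rewrite (cycle_value_next xs).
- move=> {}x y kx xy; have xs : ~~ is_sink G x by rewrite /is_sink kx.
  have [lb _] := vertex_clamp_min xs c01 cS sc aa kx.
  by rewrite (cycle_value_next xs); exact: lb.
- move=> {}x kx sigma tau; have xs : ~~ is_sink G x by rewrite /is_sink kx.
  by rewrite {1}(cycle_value_next xs) (vertex_clamp_ave xs c01 cS sc aa sigma tau kx).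
- exact: cycle_value_least.
Qed.

End CycleValue.

End VertexClamp.

(** * The program *)

Fixpoint iwrites (c : cmd) : seq nat :=
  match c with
  | Skip | QStore _ _ _ => [::]
  | IStore a _ _ => [:: a]
  | Seq c1 c2 | If _ c1 c2 => iwrites c1 ++ iwrites c2
  | While _ c1 => iwrites c1
  end.

Fixpoint qwrites (c : cmd) : seq nat :=
  match c with
  | Skip | IStore _ _ _ => [::]
  | QStore a _ _ => [:: a]
  | Seq c1 c2 | If _ c1 c2 => qwrites c1 ++ qwrites c2
  | While _ c1 => qwrites c1
  end.

(** The frame condition: invariants need only speak of the arrays that a command writes. *)
Definition agree (c : cmd) (s s' : state) : Prop :=
  (forall a i, a \notin iwrites c -> imem s' a i = imem s a i) /\
  (forall a i, a \notin qwrites c -> qmem s' a i = qmem s a i).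

Lemma agree_refl c s : agree c s s.
Proof. by []. Qed.

Lemma agree_trans c s s1 s2 : agree c s s1 -> agree c s1 s2 -> agree c s s2.
Proof.
move=> [i1 q1] [i2 q2]; split=> a i ca; first by rewrite i2 // i1.
by rewrite q2 // q1.
Qed.

Lemma exec_agree c s k s' : exec c s k s' -> agree c s s'.
Proof.
elim=> {c s k s'} [s|a e v s|a e v s|c1 c2 s k1 s1 k2 s2 _ [i1 q1] _ [i2 q2]
  |b c1 c2 s k s1 _|b c s _|b c s k1 s1 k2 s2 _ _ a1 _ a2].
- exact: agree_refl.
- by split=> // a' i /=; rewrite inE /upd => /negbTE ->.
- by split=> // a' i /=; rewrite inE /upd => /negbTE ->.
- split=> a i /=; rewrite mem_cat negb_or => /andP[n1 n2]; first by rewrite i2 ?i1.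
  by rewrite q2 ?q1.
- case: (beval s b) => -[i1 q1]; split=> a i /=; rewrite mem_cat negb_or => /andP[n1 n2];
    by [exact: i1 | exact: q1].
- exact: agree_refl.
- exact: agree_trans a1 a2.
Qed.

(** A total correctness triple with time bound [K], for a fixed initial state. *)
Definition runs (c : cmd) (s : state) (K : nat) (Q : state -> Prop) : Prop :=
  exists k s', [/\ exec c s k s', (k <= K)%N & Q s'].

Lemma runs_weaken c s K K' (Q Q' : state -> Prop) : runs c s K Q -> (K <= K')%N ->
  (forall s', agree c s s' -> Q s' -> Q' s') -> runs c s K' Q'.
Proof.
move=> [k [s' [ex kK Qs]]] KK' QQ'; exists k, s'; split=> //; first exact: leq_trans kK KK'.
by apply: QQ' => //; exact: exec_agree ex.
Qed.

Lemma runs_seq c1 c2 s K1 K2 Q :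
  runs c1 s K1 (fun s1 => runs c2 s1 K2 Q) -> runs (Seq c1 c2) s (K1 + K2) Q.
Proof.
move=> [k1 [s1 [e1 k1K [k2 [s2 [e2 k2K Qs]]]]]].
exists (k1 + k2)%N, s2; split=> //; [exact: ExecSeq e1 e2 | exact: leq_add].
Qed.

Lemma runs_if b c1 c2 s K Q :
  runs (if beval s b then c1 else c2) s K Q -> runs (If b c1 c2) s (bcost b + K) Q.
Proof.
move=> [k [s' [e kK Qs]]]; exists (bcost b + k)%N, s'; split=> //; first exact: ExecIf.
by rewrite leq_add2l.
Qed.

(** There are exactly [N] rounds and one final failing test. The bound [K] depends on the round
    because adjacency lists differ in length. *)
Lemma runs_while (I : nat -> state -> Prop) (N : nat) (K : nat -> nat) b c s :
  I 0%N s ->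
  (forall t s', (t < N)%N -> I t s' -> agree c s s' ->
    beval s' b /\ runs c s' (K t) (I t.+1)) ->
  (forall s', I N s' -> agree c s s' -> ~~ beval s' b) ->
  runs (While b c) s (\sum_(0 <= t < N) (bcost b + K t) + bcost b) (I N).
Proof.
move=> I0 step stop.
suff H j t s' : (t + j = N)%N -> I t s' -> agree c s s' ->
    runs (While b c) s' (\sum_(t <= i < N) (bcost b + K i) + bcost b) (I N).
  exact: (H N 0%N s).
elim: j t s' => [|j IH] t s'.
  rewrite addn0 => -> It ag; rewrite big_geq // add0n.
  by exists (bcost b), s'; split=> //; apply: ExecWhileStop; exact: stop.
move=> tj It ag; have tN : (t < N)%N by rewrite -tj addnS ltnS leq_addr.
have [bt [k1 [s1 [e1 k1K I1]]]] := step t s' tN It ag.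
have [|||k2 [s2 [e2 k2K I2]]] := IH t.+1 s1; rewrite ?addSnnS //.
  exact: agree_trans ag (exec_agree e1).
exists (bcost b + k1 + k2)%N, s2; split=> //; first exact: ExecWhileLoop e1 e2.
by rewrite big_ltn //; move: k1K k2K; lia.
Qed.

(** [While] is not supported: [den] is only meaningful on loop-free commands. *)
Fixpoint den (c : cmd) (s : state) : state :=
  match c with
  | Skip | While _ _ => s
  | IStore a e v => State (upd (imem s) a (ieval s e) (ieval s v)) (qmem s)
  | QStore a e v => State (imem s) (upd (qmem s) a (ieval s e) (qeval s v))
  | Seq c1 c2 => den c2 (den c1 s)
  | If b c1 c2 => if beval s b then den c1 s else den c2 s
  end.

Fixpoint loop_free (c : cmd) : bool :=
  match c with
  | Seq c1 c2 | If _ c1 c2 => loop_free c1 && loop_free c2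
  | While _ _ => false
  | _ => true
  end.

Fixpoint max_cost (c : cmd) : nat :=
  match c with
  | Skip | While _ _ => 0
  | IStore _ e v => (icost e + icost v).+1
  | QStore _ e v => (icost e + qcost v).+1
  | Seq c1 c2 => max_cost c1 + max_cost c2
  | If b c1 c2 => bcost b + maxn (max_cost c1) (max_cost c2)
  end.

Lemma runs_loop_free c s (Q : state -> Prop) : loop_free c -> Q (den c s) ->
  runs c s (max_cost c) Q.
Proof.
elim: c s Q => [|a e v|a e v|c1 IH1 c2 IH2|b c1 IH1 c2 IH2|b c _] s Q //=.
- by exists 0%N, s; split=> //; exact: ExecSkip.
- by exists (icost e + icost v).+1; eexists; split; [exact: ExecIStore| |].
- by exists (icost e + qcost v).+1; eexists; split; [exact: ExecQStore| |].
- by move=> /andP[l1 l2] Qs; apply: runs_seq; apply: IH1 => //; exact: IH2.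
- move=> /andP[l1 l2] Qs; apply: runs_if.
  case: (beval s b) Qs => Qs.
    by apply: runs_weaken (IH1 s Q l1 Qs) _ _; rewrite ?leq_maxl.
  by apply: runs_weaken (IH2 s Q l2 Qs) _ _; rewrite ?leq_maxr.
Qed.

#[local] Arguments upd : simpl never.

Lemma upd_same (X : Type) (m : nat -> nat -> X) a i v : upd m a i v a i = v.
Proof. by rewrite /upd !eqxx. Qed.

Lemma upd_upd (X : Type) (m : nat -> nat -> X) a i v w :
  upd (upd m a i v) a i w = upd m a i w.
Proof. by apply/funext => b; apply/funext => j; rewrite /upd; case: (_ && _). Qed.

(** * The commands of the solver *)

Definition ivar (a : nat) : iexp := ILoad a (IConst 0).
Definition qvar (a : nat) : qexp := QLoad a (IConst 0).
Definition iset (a : nat) (e : iexp) : cmd := IStore a (IConst 0) e.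
Definition qset (a : nat) (e : qexp) : cmd := QStore a (IConst 0) e.
Definition block (cs : seq cmd) : cmd := foldr Seq Skip cs.
Definition ilt (e1 e2 : iexp) : bexp := BNot (BILe e2 e1).

(** Memory layout. Integer arrays: 4 successor on the cycle, 5 cycle order, and the
    scalars 6 loop counter, 7 arc counter, 8 number of inner vertices, 9 current vertex,
    10 current successor. Rational arrays: 2 to 5 the clamps of the vertices, and the
    scalars 6 to 9 the current clamp, 10 the current value. *)
Definition kind_case (kmax kmin kave : cmd) : cmd :=
  If (BILe (ILoad 1 (ivar 6)) (IConst 0)) kmax
    (If (BILe (ILoad 1 (ivar 6)) (IConst 1)) kmin kave).

(** Performs [clamp_arc] on the rational scalars 6 to 9, and records an inner successor in the
    integer scalar 10. *)
Definition arc_cmd : cmd := block [::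
  iset 9 (ILoad 3 (ivar 7));
  If (BILe (IConst 3) (ILoad 1 (ivar 9)))
    (kind_case (If (BQLe (qvar 8) (QLoad 0 (ivar 9))) (qset 8 (QLoad 0 (ivar 9))) Skip)
               (If (BQLe (QLoad 0 (ivar 9)) (qvar 9)) (qset 9 (QLoad 0 (ivar 9))) Skip)
               (qset 7 (QAdd (qvar 7) (QDiv (QLoad 0 (ivar 9)) (QConst 2)))))
    (Seq (iset 10 (ivar 9))
         (kind_case (qset 6 (QConst 1))
                    (Seq (qset 6 (QConst 1)) (qset 7 (QConst 0)))
                    (qset 6 (QAdd (qvar 6) (QConst (1 / 2))))));
  iset 7 (IAdd (ivar 7) (IConst 1))].

Definition arcs_loop : cmd :=
  While (ilt (ivar 7) (ILoad 2 (IAdd (ivar 6) (IConst 1)))) arc_cmd.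

(** Every inner vertex overwrites cell 0 of the integer array 5, so the cycle order will start at
    the last one. The successor is preset to the vertex itself, the default of [next_vertex]. *)
Definition vertex_init : cmd := block [::
  iset 5 (ivar 6); iset 8 (IAdd (ivar 8) (IConst 1)); iset 10 (ivar 6);
  iset 7 (ILoad 2 (ivar 6));
  qset 6 (QConst 0); kind_case (qset 7 (QConst 0)) (qset 7 (QConst 1)) (qset 7 (QConst 0));
  qset 8 (QConst 0); qset 9 (QConst 1)].

Definition vertex_save : cmd := block [::
  IStore 4 (ivar 6) (ivar 10);
  QStore 2 (ivar 6) (qvar 6); QStore 3 (ivar 6) (qvar 7);
  QStore 4 (ivar 6) (qvar 8); QStore 5 (ivar 6) (qvar 9)].

Definition vertex_cmd : cmd :=
  Seq (If (BILe (IConst 3) (ILoad 1 (ivar 6)))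
         (QStore 1 (ivar 6) (QLoad 0 (ivar 6)))
         (Seq vertex_init (Seq arcs_loop vertex_save)))
      (iset 6 (IAdd (ivar 6) (IConst 1))).

Definition vertex_loop : cmd := While (ilt (ivar 6) (ivar 0)) vertex_cmd.

Definition order_cmd : cmd :=
  Seq (IStore 5 (IAdd (ivar 6) (IConst 1)) (ILoad 4 (ILoad 5 (ivar 6))))
      (iset 6 (IAdd (ivar 6) (IConst 1))).

Definition order_loop : cmd := While (ilt (ivar 6) (ivar 8)) order_cmd.

(** On the scalars 8 and 9 this composes the bounds as in [clamp_comp]; on the scalar 10 it
    evaluates the clamp. *)
Definition clamp_cmd (a : nat) : cmd := block [::
  qset a (QAdd (QMul (QLoad 2 (ivar 9)) (qvar a)) (QLoad 3 (ivar 9)));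
  If (BQLe (QLoad 5 (ivar 9)) (qvar a)) (qset a (QLoad 5 (ivar 9))) Skip;
  If (BQLe (qvar a) (QLoad 4 (ivar 9))) (qset a (QLoad 4 (ivar 9))) Skip].

Definition pass_head : cmd := block [::
  iset 6 (ISub (ivar 6) (IConst 1)); iset 9 (ILoad 5 (ivar 6));
  qset 6 (QMul (QLoad 2 (ivar 9)) (qvar 6));
  qset 7 (QAdd (QMul (QLoad 2 (ivar 9)) (qvar 7)) (QLoad 3 (ivar 9)))].

Definition pass_cmd : cmd :=
  Seq pass_head (Seq (clamp_cmd 8) (Seq (clamp_cmd 9) (Seq (clamp_cmd 10)
    (QStore 1 (ivar 9) (qvar 10))))).

(** Run twice, backwards along the cycle: the first tour is for the composed clamp, the second for
    the values, and it overwrites the outputs of the first. *)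
Definition pass_loop : cmd := While (BILe (IConst 1) (ivar 6)) pass_cmd.

Definition pass_init : cmd := block [:: iset 6 (ivar 8);
  qset 6 (QConst 1); qset 7 (QConst 0); qset 8 (QConst 0); qset 9 (QConst 1)].

(** Division by zero gives 0 on the machine as it does in [clamp_fix]. The counter is reset for the
    second tour. *)
Definition fix_cmd : cmd := block [:: iset 6 (ivar 8);
  qset 10 (QDiv (qvar 7) (QSub (QConst 1) (qvar 6)));
  If (BQLe (qvar 9) (qvar 10)) (qset 10 (qvar 9)) Skip;
  If (BQLe (qvar 10) (qvar 8)) (qset 10 (qvar 8)) Skip].

Definition solver : cmd :=
  Seq vertex_loop (Seq (iset 6 (IConst 0)) (Seq order_loop
    (Seq pass_init (Seq pass_loop (Seq fix_cmd pass_loop))))).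

Lemma den_clamp_cmd a s : (5 < a)%N ->
  let f := Clamp (qmem s 2 (imem s 9 0)) (qmem s 3 (imem s 9 0))
                 (qmem s 4 (imem s 9 0)) (qmem s 5 (imem s 9 0)) in
  den (clamp_cmd a) s = State (imem s) (upd (qmem s) a 0 (clamp_eval f (qmem s a 0))).
Proof.
move=> a5 f; have ne b : (b < 6)%N -> (b == a) = false by move=> b6; apply/negbTE; lia.
have updne b i v : (b < 6)%N -> upd (qmem s) a 0 v b i = qmem s b i.
  by move=> /ne b6; rewrite /upd b6.
rewrite /clamp_eval /= minEle maxC maxEle !upd_same !updne //.
case: (qmem s 5 _ <= _); rewrite /= ?upd_upd ?upd_same ?updne //; case: ifP => _; rewrite /= ?upd_upd ?updne //.
Qed.

(** * Reading the encoded game *)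

Section KeptInput.
Variables (n : nat) (G : ssg n) (adj : 'I_n -> seq 'I_n).

Local Notation inp := (input G adj).

Definition keeps_input (s : state) : Prop :=
  (forall a i, (a < 4)%N -> imem s a i = imem inp a i) /\ forall i, qmem s 0 i = qmem inp 0 i.

Definition offset (x : 'I_n) := sumn (take x (shape (adj_rows adj))).

Lemma nth_enum_map (U : Type) (u : U) (F : 'I_n -> U) (x : 'I_n) :
  nth u [seq F y | y <- enum 'I_n] x = F x.
Proof. by rewrite (nth_map x) ?nth_ord_enum // size_enum_ord. Qed.

Lemma nth_shape_adj (x : 'I_n) : nth 0%N (shape (adj_rows adj)) x = size (adj x).
Proof. by rewrite /shape -map_comp nth_enum_map /= size_map. Qed.

Lemma keeps_n s : keeps_input s -> imem s 0 0 = n.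
Proof. by case=> -> //. Qed.

Lemma keeps_kind s (x : 'I_n) : keeps_input s -> imem s 1 x = kind_code (kind_of G x).
Proof. by case=> -> // _; rewrite /= nth_enum_map. Qed.

Lemma keeps_offset s (x : 'I_n) : keeps_input s -> imem s 2 x = offset x.
Proof. by case=> -> // _; rewrite /= ltnW. Qed.

Lemma keeps_offsetS s (x : 'I_n) : keeps_input s -> imem s 2 x.+1 = (offset x + size (adj x))%N.
Proof.
case=> -> // _; rewrite /= ltn_ord (take_nth 0%N) ?sumn_rcons ?nth_shape_adj //.
by rewrite /shape /adj_rows 2!size_map size_enum_ord.
Qed.

Lemma keeps_adj s (x : 'I_n) j : keeps_input s -> (j < size (adj x))%N ->
  imem s 3 (offset x + j) = nth x (adj x) j :> nat.
Proof.
move=> [-> // _] jx /=; rewrite nth_flatten.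
have jx' : (j < nth 0%N (shape (adj_rows adj)) x)%N by rewrite nth_shape_adj.
rewrite (flatten_indexKl jx') (flatten_indexKr jx') nth_enum_map.
by rewrite (nth_map x).
Qed.

Lemma keeps_sink_val s (x : 'I_n) : keeps_input s -> is_sink G x -> qmem s 0 x = sink_val G x.
Proof. by case=> _ -> xs; rewrite /= nth_enum_map xs. Qed.

Lemma kind_code_sink x : (2 < kind_code (kind_of G x))%N = is_sink G x.
Proof. by rewrite /is_sink; case: kind_of. Qed.

End KeptInput.

Lemma updE (X : Type) (m : nat -> nat -> X) a i v a' i' :
  upd m a i v a' i' = if (a' == a) && (i' == i) then v else m a' i'.
Proof. by []. Qed.

Lemma runs_chain c1 c2 s K1 K2 (Q1 Q : state -> Prop) : runs c1 s K1 Q1 ->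
  (forall s1, agree c1 s s1 -> Q1 s1 -> runs c2 s1 K2 Q) -> runs (Seq c1 c2) s (K1 + K2) Q.
Proof.
by move=> r1 r2; apply: runs_seq; apply: runs_weaken r1 (leqnn _) _ => s1; exact: r2.
Qed.

(** * The first loop: successors and clamps of the vertices *)

Section VertexLoop.
Variables (n : nat) (G : ssg n) (adj : 'I_n -> seq 'I_n).
Hypothesis adjP : adjacency_lists G adj.

Local Notation inp := (input G adj).
Local Notation kept := (keeps_input G adj).

Definition cur_clamp (s : state) : clamp :=
  Clamp (qmem s 6 0) (qmem s 7 0) (qmem s 8 0) (qmem s 9 0).

Definition last_inner (x : 'I_n) (ys : seq 'I_n) : 'I_n :=
  foldl (fun z y => if is_sink G y then z else y) x ys.

Lemma den_arc_cmd s (x y : 'I_n) : kept s -> ~~ is_sink G x ->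
  imem s 6 0 = x -> imem s 3 (imem s 7 0) = y ->
  [/\ cur_clamp (den arc_cmd s) = clamp_arc G (kind_of G x) (cur_clamp s) y,
      imem (den arc_cmd s) 10 0 = if is_sink G y then imem s 10 0 else y
    & imem (den arc_cmd s) 7 0 = (imem s 7 0 + 1)%N].
Proof.
move=> ks xs sx sy.
have kx := keeps_kind x ks; have ky := keeps_kind y ks.
have yv := keeps_sink_val (x := y) ks.
have := kind_code_sink G y; move: xs kx; rewrite /is_sink /cur_clamp /clamp_arc -/(is_sink G y).
by case: (kind_of G x) => //= _ kx; rewrite ?updE /= sy ky => ->; case: ifP => ys;
  rewrite /= ?updE /= ?sx ?kx /= ?updE /= ?sy ?(yv ys) //= ?updE /= ?sy ?maxEle ?minEle //;
  case: ifP => c; rewrite /= ?updE /= ?sy ?(yv ys) ?c.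
Qed.

Lemma kept_agree c s s' : all (leq 4) (iwrites c) -> 0%N \notin qwrites c ->
  agree c s s' -> kept s -> kept s'.
Proof.
move=> /allP iw qw [ai aq] [ki kq]; split=> [a i a4|i]; last by rewrite aq.
by rewrite ai ?ki //; apply/negP => /iw; rewrite leqNgt a4.
Qed.

Lemma last_innerP x ys :
  (forall y, y \in ys -> is_sink G y) /\ last_inner x ys = x \/
  last_inner x ys \in ys /\ ~~ is_sink G (last_inner x ys).
Proof.
rewrite /last_inner; elim/last_ind: ys => [|ys y IH]; first by left.
rewrite foldl_rcons; case: ifPn => ysink; last by right; rewrite mem_rcons mem_head.
case: IH => -[h1 h2]; [left|right]; split=> //; last by rewrite mem_rcons inE h1 orbT.
by move=> z; rewrite mem_rcons inE => /predU1P[->|/h1].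
Qed.

(** All inner successors of [x] coincide, so the last one read is the next vertex; if there is none,
    both sides default to [x]. *)
Lemma last_inner_next x : strongly_connected G -> almost_acyclic G -> ~~ is_sink G x ->
  last_inner x (adj x) = next_vertex G x.
Proof.
move=> sc aa xs; case: (last_innerP x (adj x)) => -[h1 h2].
  rewrite h2 /next_vertex; case: pickP => [y /andP[xy ys]|//].
  by move: ys; rewrite h1 // (mem_adj adjP).
by apply/esym/next_vertexE => //; rewrite -(mem_adj adjP).
Qed.

(** The 9 pays for the loop test. *)
Definition arc_cost : nat := 9 + max_cost arc_cmd.

Lemma runs_arcs_loop s x : kept s -> ~~ is_sink G x -> imem s 6 0 = x ->
  imem s 7 0 = offset adj x -> cur_clamp s = clamp_init (kind_of G x) -> imem s 10 0 = x ->
  runs arcs_loop s (size (adj x) * arc_cost + 9) (fun s' =>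
    cur_clamp s' = vertex_clamp G adj x /\ imem s' 10 0 = last_inner x (adj x)).
Proof.
move=> ks xs s6 s7 sc s10.
pose I j s' := [/\ imem s' 7 0 = (offset adj x + j)%N,
  cur_clamp s' = clamp_arcs G (kind_of G x) (take j (adj x)) &
  imem s' 10 0 = last_inner x (take j (adj x))].
apply: (runs_weaken (runs_while (I := I) (N := size (adj x)) (K := fun=> max_cost arc_cmd) _ _ _)).
- by split; rewrite ?addn0 ?take0.
- move=> j s' jx [i7 ic i10] ag; have ks' := kept_agree (c := arc_cmd) isT isT ag ks.
  have s6' : imem s' 6 0 = x by rewrite ag.1.
  split.
    rewrite /= s6' addn1 (keeps_offsetS x ks') i7 -ltnNge ltn_add2l; exact: jx.
  apply: runs_loop_free => //.
  have s3 := keeps_adj ks' jx; rewrite -i7 in s3.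
  have [c1 c2 c3] := den_arc_cmd ks' xs s6' s3.
  by rewrite /I (take_nth x jx) /clamp_arcs /last_inner !foldl_rcons c1 c2 c3 i7 ic i10;
    split => //; [rewrite addn1 addnS | case: ifP].
- move=> s' [i7 _ _] ag; have ks' := kept_agree (c := arc_cmd) isT isT ag ks.
  by rewrite /= (ag.1 6) // s6 addn1 (keeps_offsetS x ks') i7 negbK.
- by rewrite sum_nat_const_nat subn0 /arc_cost.
- by move=> s' _ [_]; rewrite take_size.
Qed.

Definition cell_clamp (s : state) (i : nat) : clamp :=
  Clamp (qmem s 2 i) (qmem s 3 i) (qmem s 4 i) (qmem s 5 i).

Hypotheses (sc : strongly_connected G) (aa : almost_acyclic G).

Definition vertex_done (s : state) (x : 'I_n) : Prop :=
  if is_sink G x then qmem s 1 x = sink_val G x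
  else imem s 4 x = next_vertex G x /\ cell_clamp s x = vertex_clamp G adj x.

Definition vertex_inv (i : nat) (s : state) : Prop :=
  [/\ imem s 6 0 = i,
      imem s 8 0 = count (fun x => ~~ is_sink G x) (take i (enum 'I_n)),
      forall x : 'I_n, (x < i)%N -> ~~ is_sink G x ->
        exists2 y : 'I_n, ~~ is_sink G y & imem s 5 0 = y &
      forall x : 'I_n, (x < i)%N -> vertex_done s x].

Lemma runs_vertex_cmd s (x : 'I_n) : kept s -> vertex_inv x s ->
  runs vertex_cmd s (size (adj x) * arc_cost + 100) (vertex_inv x.+1).
Proof.
move=> ks [s6 s8 s5 sd].
have kx := keeps_kind x ks.
have take_enum : take x.+1 (enum 'I_n) = rcons (take x (enum 'I_n)) x.
  by rewrite (take_nth x) ?nth_ord_enum // size_enum_ord.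
have nex (y : 'I_n) : (y < x)%N -> (y == x :> nat) = false by move=> yx; apply/negbTE; lia.
have leS (y : 'I_n) : (y < x.+1)%N -> (y < x)%N \/ y = x.
  by rewrite ltnS leq_eqVlt => /predU1P[/val_inj|]; [right|left].
have [xs|xs] := boolP (is_sink G x).
  apply: (@runs_weaken _ _ (bcost (BILe (IConst 3) (ILoad 1 (ivar 6))) + max_cost (QStore 1 (ivar 6) (QLoad 0 (ivar 6))) + max_cost (iset 6 (IAdd (ivar 6) (IConst 1))))%N); last 2 first.
  - by rewrite /=; lia.
  - by move=> s' _; exact: id.
  apply: runs_seq; apply: runs_if; rewrite /= s6 kx kind_code_sink xs.
  apply: runs_loop_free => //; apply: runs_loop_free => //=.
  rewrite /vertex_inv /= !updE /= s6 take_enum -cats1 count_cat /= xs s8 !addn0.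
  split=> //.
  - by rewrite addn1.
  - by move=> y /leS[yx ys|-> /negP//]; exact: s5 ys.
  - move=> y /leS[yx|->]; rewrite /vertex_done /cell_clamp /= !updE /=.
      by rewrite nex //; exact: sd.
    by rewrite xs eqxx (keeps_sink_val ks xs).
apply: (@runs_weaken _ _ (bcost (BILe (IConst 3) (ILoad 1 (ivar 6))) +
  (max_cost vertex_init + ((size (adj x) * arc_cost + 9) + max_cost vertex_save)) +
  max_cost (iset 6 (IAdd (ivar 6) (IConst 1))))%N); last 2 first.
- by rewrite /=; lia.
- by move=> s' _; exact: id.
apply: runs_seq; apply: runs_if; rewrite /= s6 kx kind_code_sink (negbTE xs).
pose Q1 s1 := [/\ imem s1 6 0 = x, imem s1 7 0 = offset adj x,
   cur_clamp s1 = clamp_init (kind_of G x), imem s1 10 0 = x &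
   imem s1 5 0 = x /\ imem s1 8 0 = (imem s 8 0 + 1)%N].
apply: (runs_chain (Q1 := Q1)) => [|s1 ag1 [a6 a7 ac a10 [a5 a8]]].
  apply: runs_loop_free => //; rewrite /Q1 /cur_clamp /clamp_init /=.
  have ox := keeps_offset x ks.
  by case: (kind_of G x) xs kx => //= _ kx; rewrite ?updE /= s6 ?updE /= kx /= ?updE /= ox.
have ks1 := kept_agree (c := vertex_init) isT isT ag1 ks.
apply: (runs_chain (runs_arcs_loop ks1 xs a6 a7 ac a10)) => s2 ag2 [b1 b2].
apply: runs_loop_free => //; apply: runs_loop_free => //=.
have b6 : imem s2 6 0 = x by rewrite ag2.1.
move: b1; rewrite /cur_clamp => b1.
rewrite /vertex_inv /= !updE /= b6 take_enum -cats1 count_cat /= xs addn0.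
split.
- by rewrite addn1.
- by rewrite ag2.1 // a8 s8.
- by move=> y _ ys; exists x => //; rewrite ag2.1.
- move=> y /leS[yx|->]; rewrite /vertex_done /cell_clamp /= !updE /=.
    rewrite nex //; have := sd y yx; rewrite /vertex_done /cell_clamp.
    by rewrite !ag2.1 // !ag2.2 // !ag1.1 // !ag1.2.
  by rewrite (negbTE xs) eqxx b2 -b1 last_inner_next.
Qed.

End VertexLoop.

(** * The cycle order and the tours along it *)

Section CycleLoops.
Variables (n : nat) (G : ssg n) (adj : 'I_n -> seq 'I_n).
Hypothesis adjP : adjacency_lists G adj.

Local Notation inp := (input G adj).
Local Notation kept := (keeps_input G adj).

Hypotheses (sc : strongly_connected G) (aa : almost_acyclic G).

Local Notation nx := (next_vertex G).
Local Notation vc := (vertex_clamp G adj).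
Local Notation m := #|[pred x | ~~ is_sink G x]|.

(** Each vertex costs at most 100 besides its arcs, and 6 for the loop test; the last 6 pays for the
    failing test. *)
Definition vertex_loop_cost : nat := (\sum_x size (adj x)) * arc_cost + 106 * n + 6.

Lemma runs_vertex_loop : runs vertex_loop inp vertex_loop_cost (vertex_inv G adj n).
Proof.
have k0 : kept inp by [].
pose K t := (nth 0%N (shape (adj_rows adj)) t * arc_cost + 100)%N.
apply: (runs_weaken (runs_while (I := vertex_inv G adj) (N := n) (K := K) _ _ _)).
- by split=> //=; rewrite take0.
- move=> t s tn It ag; have ks := kept_agree (c := vertex_cmd) isT isT ag k0.
  have [s6 _ _ _] := It; split; first by rewrite /= s6 (keeps_n ks) -ltnNge.
  rewrite /K -[X in nth _ _ X]/(nat_of_ord (Ordinal tn)) nth_shape_adj.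
  exact: (runs_vertex_cmd adjP sc aa (x := Ordinal tn) ks It).
- move=> s [s6 _ _ _] ag; have ks := kept_agree (c := vertex_cmd) isT isT ag k0.
  by rewrite /= s6 (keeps_n ks) leqnn.
- rewrite /vertex_loop_cost /= leq_add2r.
  have -> : (\sum_x size (adj x) = \sum_(0 <= t < n) nth 0 (shape (adj_rows adj)) t)%N.
    by rewrite big_mkord; apply: eq_bigr => x _; rewrite nth_shape_adj.
  rewrite big_distrl /= -[X in (106 * X)%N]subn0 mulnC -sum_nat_const_nat -big_split /=.
  by rewrite leq_sum // => t _; rewrite /K; lia.
- by move=> s.
Qed.

Definition cycle_data (s : state) : Prop :=
  [/\ imem s 8 0 = m, forall x : 'I_n, is_sink G x -> qmem s 1 x = sink_val G x &
      forall x, ~~ is_sink G x -> imem s 4 x = nx x /\ cell_clamp s x = vc x].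

Lemma vertex_inv_cycle_data s : (0 < n)%N -> vertex_inv G adj n s ->
  exists x0 : 'I_n, [/\ forall x, ~~ is_sink G x -> ~~ is_sink G x0,
    (0 < m)%N -> imem s 5 0 = x0 & cycle_data s].
Proof.
move=> n0 [_ s8 s5 sd].
have sd' x : vertex_done G adj s x by exact: sd.
have data : cycle_data s.
  split=> [|x xs|x xs].
  - rewrite s8 take_oversize ?size_enum_ord //.
    by rewrite -sum1_count -sum1_card big_enum_cond; exact: eq_bigl.
  - by have := sd' x; rewrite /vertex_done xs.
  - by have := sd' x; rewrite /vertex_done (negbTE xs).
case: (pickP [pred x | ~~ is_sink G x]) => [x /= xs|none].
  have [y ys e] := s5 x (ltn_ord x) xs.
  by exists y; split.
(* Without inner vertices any vertex may serve as [x0]. *)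
exists (Ordinal n0); split=> // [x xs|].
  by have := none x; rewrite /= xs.
by rewrite (eq_card0 none).
Qed.

Variable x0 : 'I_n.
Hypothesis x0_inner : forall x, ~~ is_sink G x -> ~~ is_sink G x0.

Lemma cycle_data_agree c s s' : 8%N \notin iwrites c -> 4%N \notin iwrites c ->
  all (fun a => a \notin qwrites c) [:: 1; 2; 3; 4; 5]%N -> agree c s s' ->
  cycle_data s -> cycle_data s'.
Proof.
move=> w8 w4 /and5P[w1 w2 w3 wq4 /andP[w5 _]] [ai aq] [d1 d2 d3]; split.
- by rewrite ai.
- by move=> x xs; rewrite aq // d2.
- by move=> x xs; rewrite ai // /cell_clamp !aq //; exact: d3.
Qed.

Lemma m_inner : (0 < m)%N -> ~~ is_sink G x0.
Proof. by case/card_gt0P => x; exact: x0_inner. Qed.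

Lemma iter_inner j : (0 < m)%N -> ~~ is_sink G (iter j nx x0).
Proof. by move=> m0; elim: j => [|j IH] /=; [exact: m_inner | exact: next_vertex_inner]. Qed.

Definition in_order (s : state) : Prop :=
  forall j, (j < m)%N -> imem s 5 j = iter j nx x0.

Lemma runs_order_loop s : ((0 < m)%N -> imem s 5 0 = x0) -> imem s 6 0 = 0%N ->
  cycle_data s -> runs order_loop s (m * 100 + 6) in_order.
Proof.
move=> s5 s6 ds.
(* The last round also fills cell [m], where the tour is back at [x0]; [in_order] stops before
   it. *)
pose I t s' := imem s' 6 0 = t /\ forall j, (j <= t)%N -> (0 < m)%N -> imem s' 5 j = iter j nx x0.
apply: (runs_weaken (runs_while (I := I) (N := m) (K := fun=> max_cost order_cmd) _ _ _)).
- by split=> // j; rewrite leqn0 => /eqP ->.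
- move=> t s' tm [i6 i5] ag; have ds' := cycle_data_agree (c := order_cmd) isT isT isT ag ds.
  have m0 : (0 < m)%N by exact: leq_ltn_trans tm.
  have [d8 _ d4] := ds'; split; first by rewrite /= i6 d8 -ltnNge.
  apply: runs_loop_free => //=; split; rewrite /= ?updE /= i6 ?addn1 // => j.
  rewrite updE /= leq_eqVlt ltnS => /predU1P[->|jt] _.
    by rewrite upd_same i5 // (d4 _ (iter_inner t m0)).1.
  by rewrite updE /= ltn_eqF // i5.
- move=> s' [i6 i5] ag; have [d8 _ _] := cycle_data_agree (c := order_cmd) isT isT isT ag ds.
  by rewrite /= i6 d8 leqnn.
- rewrite sum_nat_const_nat subn0 /= leq_add2r leq_mul2l; apply/orP; right; by [].
- by move=> s' _ [_ i5] j jm; apply: i5; [exact: ltnW | exact: leq_ltn_trans jm].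
Qed.

Lemma den_seq c1 c2 s : den (Seq c1 c2) s = den c2 (den c1 s).
Proof. by []. Qed.

Lemma den_store a e v s :
  den (QStore a e v) s = State (imem s) (upd (qmem s) a (ieval s e) (qeval s v)).
Proof. by []. Qed.

Lemma imem_clamp_cmd a s : (5 < a)%N -> imem (den (clamp_cmd a) s) = imem s.
Proof. by move=> a5; rewrite den_clamp_cmd. Qed.

Lemma qmem_clamp_cmd a s b i : (5 < a)%N -> qmem (den (clamp_cmd a) s) b i =
  if (b == a) && (i == 0%N) then clamp_eval (cell_clamp s (imem s 9 0)) (qmem s a 0)
  else qmem s b i.
Proof. by move=> a5; rewrite den_clamp_cmd. Qed.

Lemma cell_clamp_cmd a s i : (5 < a)%N ->
  cell_clamp (den (clamp_cmd a) s) i = cell_clamp s i.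
Proof.
by move=> a5; rewrite /cell_clamp !qmem_clamp_cmd // !ifF //;
  apply/negbTE; rewrite negb_and; apply/orP; left; lia.
Qed.

#[local] Opaque clamp_cmd.

Lemma den_pass_cmd s (x : 'I_n) : imem s 5 (imem s 6 0 - 1) = x -> cell_clamp s x = vc x ->
  [/\ imem (den pass_cmd s) 6 0 = (imem s 6 0 - 1)%N,
      qmem (den pass_cmd s) 10 0 = clamp_eval (vc x) (qmem s 10 0),
      cur_clamp (den pass_cmd s) = clamp_comp (vc x) (cur_clamp s) &
      forall i, qmem (den pass_cmd s) 1 i =
        if i == x then clamp_eval (vc x) (qmem s 10 0) else qmem s 1 i].
Proof.
move=> sx <-; rewrite /pass_cmd 4!den_seq.
set s1 := den pass_head s.
have [e6 e9 e67 e1] : [/\ imem s1 6 0 = (imem s 6 0 - 1)%N, imem s1 9 0 = x,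
    qmem s1 6 0 = qmem s 2 x * qmem s 6 0 /\ qmem s1 7 0 = qmem s 2 x * qmem s 7 0 + qmem s 3 x &
    forall a i, (a < 6)%N || (7 < a)%N -> qmem s1 a i = qmem s a i].
  rewrite /s1 /= ?updE /= ?updE /= sx; split=> // a i a67; rewrite !updE /=.
  by rewrite !ifF //; apply/negP => /andP[/eqP e _]; rewrite e in a67.
have cE : cell_clamp s1 (imem s1 9 0) = cell_clamp s x by rewrite e9 /cell_clamp !e1.
move: e6 e9 e67 e1 cE; move: s1 => s1 e6 e9 [e66 e77] e1 cE.
rewrite den_store; split.
- by rewrite !imem_clamp_cmd.
- by rewrite /= updE /= !qmem_clamp_cmd //= !cell_clamp_cmd // !imem_clamp_cmd // cE e1.
- rewrite /cur_clamp /= !updE /= !qmem_clamp_cmd //= !cell_clamp_cmd // !imem_clamp_cmd // cE.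
  by rewrite e66 e77 !e1.
- move=> i; rewrite /= updE !imem_clamp_cmd // e9 !qmem_clamp_cmd //= !cell_clamp_cmd //.
  by rewrite !imem_clamp_cmd // cE !e1.
Qed.

#[local] Transparent clamp_cmd.

(** After [t] rounds the last [t] vertices of the tour from [x0] have been treated in reverse order,
    starting from the value [u] and the clamp [f]. *)
Definition pass_inv (u : rat) (f : clamp) (t : nat) (s : state) : Prop :=
  [/\ imem s 6 0 = (m - t)%N,
      qmem s 10 0 = eval_clamps vc u (traject nx (iter (m - t) nx x0) t),
      cur_clamp s = foldr (fun x => clamp_comp (vc x)) f (traject nx (iter (m - t) nx x0) t),
      forall x : 'I_n, is_sink G x -> qmem s 1 x = sink_val G x &
      forall j, (m - t <= j < m)%N ->
        qmem s 1 (iter j nx x0) = eval_clamps vc u (traject nx (iter j nx x0) (m - j))].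

Lemma runs_pass_loop s : in_order s -> cycle_data s -> imem s 6 0 = m ->
  runs pass_loop s (m * 200 + 4) (pass_inv (qmem s 10 0) (cur_clamp s) m).
Proof.
move=> os [s8 ss sd] s6.
apply: (runs_weaken (runs_while (I := pass_inv (qmem s 10 0) (cur_clamp s)) (N := m)
  (K := fun=> max_cost pass_cmd) _ _ _)).
- by rewrite /pass_inv subn0; split=> // j /andP[]; lia.
- move=> t s' tm [i6 iu ic is_ io] ag; have m0 : (0 < m)%N by exact: leq_ltn_trans tm.
  split; first by rewrite /= i6 subn_gt0.
  apply: runs_loop_free => //; set x := iter (m - t.+1) nx x0.
  have xs : ~~ is_sink G x by exact: iter_inner.
  have s5 : imem s' 5 (imem s' 6 0 - 1) = x.
    by rewrite i6 -subnDA addn1 ag.1 // os // ltn_subrL.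
  have cx : cell_clamp s' x = vc x by rewrite /cell_clamp !ag.2 //; case: (sd x xs).
  have [d6 du dc do_] := den_pass_cmd s5 cx.
  have xE : iter (m - t) nx x0 = nx x by rewrite -(subnSK tm).
  split.
  - by rewrite d6 i6 -subnDA addn1.
  - by rewrite du iu xE.
  - by rewrite dc ic xE.
  - move=> y ys; rewrite do_ is_ //; case: eqP => // /val_inj yx.
    by move: xs; rewrite -yx ys.
  - move=> j /andP[tj jm]; rewrite do_; move: tj; rewrite leq_eqVlt => /predU1P[<-|tj].
      by rewrite eqxx iu xE subKn.
    rewrite io; last by rewrite jm andbT; lia.
    (* Distinct positions below [m] carry distinct vertices, so this write leaves the finished
       outputs alone. *)
    case: eqP => // /val_inj /(congr1 (findex nx x0)).
    have x0s := m_inner m0.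
    by rewrite !findex_iter ?(order_inner sc aa) //; lia.
- by move=> s' [i6 _ _ _ _] _; rewrite /= i6 subnn.
- rewrite sum_nat_const_nat subn0 /= leq_add2r leq_mul2l; apply/orP; right; by [].
- by move=> s' _.
Qed.

Lemma den_fix_cmd s : [/\ imem (den fix_cmd s) 6 0 = imem s 8 0,
  qmem (den fix_cmd s) 10 0 = clamp_fix (cur_clamp s) &
  cur_clamp (den fix_cmd s) = cur_clamp s].
Proof.
rewrite /clamp_fix /cur_clamp minEle maxC maxEle /fix_cmd [block _]/= !den_seq.
set s1 := den (qset _ _) _.
have e : [/\ imem s1 6 0 = imem s 8 0, qmem s1 10 0 = qmem s 7 0 / (1 - qmem s 6 0) &
  forall a i, (a < 10)%N -> qmem s1 a i = qmem s a i].
  by split=> // a i a10; rewrite /s1 /= updE ltn_eqF.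
case: e => e6 <- ea; move: e6 ea; move: s1 => s1 e6 ea /=; rewrite -!ea //.
by case: (qmem s1 9 0 <= _); rewrite /= ?updE /= ?updE /=; case: ifP => c; rewrite /= ?updE /= ?updE /=.
Qed.

End CycleLoops.

(** * Correctness and running time of the solver *)

Definition solver_cost (n d : nat) : nat := (d * arc_cost + n * 1000 + 1000)%N.

Lemma runs_solver n (G : ssg n) (adj : 'I_n -> seq 'I_n) :
  (0 < n)%N -> adjacency_lists G adj -> strongly_connected G -> almost_acyclic G ->
  runs solver (input G adj) (solver_cost n (\sum_x size (adj x))) (fun s =>
    exists2 x0 : 'I_n, (forall x, ~~ is_sink G x -> ~~ is_sink G x0) &
      forall x : 'I_n, output s x = cycle_value G adj x0 x).
Proof.
move=> n0 adjP sc aa; set m := #|[pred x | ~~ is_sink G x]|.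
have mn : (m <= n)%N by rewrite -[n in (_ <= n)%N]card_ord max_card.
apply: (@runs_weaken _ _ (vertex_loop_cost adj + (max_cost (iset 6 (IConst 0)) +
  ((m * 100 + 6) + (max_cost pass_init + ((m * 200 + 4) + (max_cost fix_cmd + (m * 200 + 4)))))))%N);
  last 2 first.
- by rewrite /vertex_loop_cost /solver_cost /=; move: mn; lia.
- by move=> s _; exact: id.
apply: (runs_chain (runs_vertex_loop adjP sc aa)) => s1 _ /(vertex_inv_cycle_data n0)[x0 [x0i s5 d1]].
apply: runs_seq; apply: runs_loop_free => //; set s2 := den _ s1.
have d2 : cycle_data G adj s2 by [].
apply: (runs_chain (runs_order_loop x0i (s := s2) s5 erefl d2)) => s3 ag3 o3.
have d3 := cycle_data_agree (c := order_loop) isT isT isT ag3 d2.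
apply: runs_seq; apply: runs_loop_free => //; set s4 := den _ s3.
have d4 : cycle_data G adj s4 by [].
have o4 : in_order G x0 s4 by [].
have i4 : imem s4 6 0 = m by case: d3.
apply: (runs_chain (runs_pass_loop sc aa x0i o4 d4 i4)) => s5' ag5 [i5 _ c5 k5 _].
(* The first tour started with the identity clamp in the scalars, so it leaves the composition
   around the whole cycle. *)
have {}c5 : cur_clamp s5' = comp_clamps (vertex_clamp G adj) (traject (next_vertex G) x0 m).
  by rewrite c5 subnn.
(* The tour writes to the output array, so the sink outputs are taken from its invariant instead of
   the frame condition. *)
have d5 : cycle_data G adj s5'.
  case: d4 => d8 _ dd; split=> // [|x xs]; first by rewrite ag5.1.
  by rewrite ag5.1 // /cell_clamp !ag5.2 //; exact: dd.
have o5 : in_order G x0 s5' by move=> j jm; rewrite ag5.1 // o4.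
apply: runs_seq; apply: runs_loop_free => //.
have [i6 u6 _] := den_fix_cmd s5'; have ag6 : agree fix_cmd s5' (den fix_cmd s5').
  by case: (runs_loop_free (c := fix_cmd) (Q := eq (den fix_cmd s5')) isT erefl) => k [s [/exec_agree ag _ ->]].
move: (den _ s5') i6 u6 ag6 => s6 i6 u6 ag6.
have d6 := cycle_data_agree (c := fix_cmd) isT isT isT ag6 d5.
have o6 : in_order G x0 s6 by move=> j jm; rewrite ag6.1 // o5.
have {}i6 : imem s6 6 0 = m by rewrite i6; case: d5.
(* The second tour starts from the fixed point, which is the value of [x0]. *)
apply: (runs_weaken (runs_pass_loop sc aa x0i o6 d6 i6) (leqnn _)) => s7 _ [_ _ _ k7 out7].
exists x0 => // x; rewrite /output /cycle_value; case: ifPn => [|xs]; first exact: k7.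
have := out7 (findex (next_vertex G) x0 x); rewrite subnn (iter_findex_inner sc aa x0i xs).
by rewrite u6 c5 => ->//; exact: findex_inner.
Qed.

(** Two arcs per vertex cover the average vertices and the sinks; [excess_arcs] counts what
    positional vertices have beyond that. *)
Lemma sum_size_adj n (G : ssg n) (adj : 'I_n -> seq 'I_n) : adjacency_lists G adj ->
  (\sum_x size (adj x) <= 2 * n + excess_arcs G)%N.
Proof.
move=> adjP; rewrite /excess_arcs [X in (_ <= _ + X)%N]big_mkcond.
have -> : (2 * n = \sum_(x < n) 2)%N by rewrite sum_nat_const card_ord mulnC.
rewrite -big_split /=.
apply: leq_sum => x _; rewrite (size_adj adjP).
case kx: (kind_of G x) => /=; [lia|lia|by rewrite (ave_outdeg kx)|].
rewrite (eq_card (B := pred1 x)) ?card1 // => y.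
by rewrite !inE; exact: (sink_loop kx).
Qed.

Theorem theorem6 :
  exists (c : cmd) (C : nat),
  forall (n : nat) (G : ssg n) (adj : 'I_n -> seq 'I_n),
    (0 < n)%N -> adjacency_lists G adj ->
    strongly_connected G -> almost_acyclic G ->
  exists (k : nat) (s : state),
    [/\ exec c (input G adj) k s,
        (k <= C * (n + excess_arcs G))%N
      & forall (R : realType) (d : measure_display) (T : measurableType d)
          (P : probability T R) (coin : nat -> T -> bool),
          fair_coins P coin ->
          forall x : 'I_n, ratr (output s x) = game_val P coin G x].
Proof.
(* There are at most [2 * n + excess_arcs G] arcs, whence [2 * arc_cost]; as [n] is positive,
   [n * 1000 + 1000] is at most [2000 * n]. *)
exists solver, (2 * arc_cost + 2000)%N => n G adj n0 adjP sc aa.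
have [k [s [ex kK [x0 x0i out]]]] := runs_solver n0 adjP sc aa.
exists k, s; split=> // [|R d T P coin fair x].
  apply: leq_trans kK _; rewrite /solver_cost.
  have := leq_mul (sum_size_adj adjP) (leqnn arc_cost); move: n0; nia.
by rewrite out (game_val_cycle_value adjP sc aa x0i x fair).
Qed.
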